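(* For all weak compositions $\alpha$ and $\beta$, the renormalized monomial quasisymmetric functions satisfy $$M_\alpha M_\beta=M_{\alpha*\beta},$$ where $*$ is the quasi-shuffle product of weak compositions and $M$ is extended linearly. Consequently, the set $\mathrm{RenQSym}$ of all $\mathbf k$-linear combinations of renormalized monomial quasisymmetric functions is a subalgebra of $\mathbf k[[X]][t]$.
   Context: $\mathbf k$ is a commutative ring containing $\mathbb Q$. $\mathbb P$ and $\mathbb N$ denote the positive and nonnegative integers. A weak composition is a finite sequence of nonnegative integers, possibly empty. Let $X=\{x_i:i\in\mathbb P\}$ be commuting indeterminates. Quasi-shuffle of weak compositions. $\emptyset$ is the unit, and $$a*b=(a_1,(a_2,\dots,a_m)*b)+(b_1,a*(b_2,\dots,b_n))+(a_1+b_1,(a_2,\dots,a_m)*(b_2,\dots,b_n)),$$ with $(c,\sum\lambda_uu)=\sum\lambda_u(c,u)$. The same rule, with columns added componentwise, defines the quasi-shuffle product on matrices $\binom{\alpha}{\beta}$ with $\alpha\in\mathbb N^k$, $\beta\in\mathbb P^k$. GSym. $\mathrm{GSym}\subseteq\mathbb Q[[X]]$ is the $\mathbb Q$-span of $\widehat M_{\binom{\gamma}{\mu}}=\sum_{0<i_1<\cdots<i_r}i_1^{\mu_1}\cdots i_r^{\mu_r}x_{i_1}^{\gamma_1}\cdots x_{i_r}^{\gamma_r}$, for $\gamma\in\mathbb N^r$ with $r=0$ or $\gamma_r>0$, and $\mu\in\mathbb N^r$. Regularization. For $\alpha\in\mathbb N^k$, $\beta\in\mathbb P^k$, $\phi\binom{\alpha}{\beta}\in\mathrm{GSym}[t][z^{-1},z]]$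 is obtained from $\sum_{0<i_1<\cdots<i_k}\prod_l x_{i_l}^{\alpha_l}e^{(i_l+t)\beta_lz}$. The coefficient of each $X$-monomial converges absolutely for $t\ge0$, $\mathrm{Re}(z)<0$; it is expanded as a Laurent series in $z$ with coefficients in $\mathbb Q[t]$, and powers are collected. Renormalization. Let $P$ be the polar-part projection in $z$. Set $\phi_-(\emptyset)=1$ and $$\phi_\mp\tbinom{\alpha}{\beta}=\{-P,\ \mathrm{id}-P\}\Big(\phi\tbinom{\alpha}{\beta}+\sum_{i=1}^{k-1}\phi\tbinom{\alpha_1..\alpha_i}{\beta_1..\beta_i}\phi_-\tbinom{\alpha_{i+1}..\alpha_k}{\beta_{i+1}..\beta_k}\Big),$$ i.e. $\phi_-$ uses $-P$ and $\phi_+$ uses $\mathrm{id}-P$. Put $Z\binom{\alpha}{\beta}=\phi_+\binom{\alpha}{\beta}|_{z=0}\in\mathrm{GSym}[t]$. Renormalized monomial quasisymmetric functions. For a weak composition $\alpha$ of length $k$, $M_\alpha:=Z\binom{\alpha}{\delta,\dots,\delta}$ for $\delta\in\mathbb P$; this does not depend on $\delta$. Also $M_\emptyset=1$. When the last entry of $\alpha$ is positive, $M_\alpha=\sum_{0<i_1<\cdots<i_k}x_{i_1}^{\alpha_1}\cdots x_{i_k}^{\alpha_k}$. *)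

(* Defs.v *)
From HB Require Import structures.
From mathcomp Require Import all_boot all_order all_algebra.
From mathcomp Require Import all_classical all_reals all_analysis.
From mathcomp Require Import Rstruct Rstruct_topology.

Set Implicit Arguments.
Unset Strict Implicit.
Unset Printing Implicit Defensive.

Import Order.TTheory GRing.Theory Num.Theory.
Local Open Scope classical_set_scope.
Local Open Scope ring_scope.

(* Weak compositions are [seq nat].                                    *)
(* X-monomials: [m : seq nat] encodes prod_p x_(p+1)^(nth 0 m p)       *)
(* (trailing zeros are irrelevant; every coefficient function below    *)
(* is invariant under appending zeros).                                *)
Definition mon := seq nat.

(* elements of Q[[X]][t] : coefficient of each X-monomial in Q[t] *)
Definition qser := mon -> {poly rat}.
(* elements of Q[[X]][t][z^-1,z]] : coefficient of x^m z^n in Q[t] *)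
Definition lser := mon -> int -> {poly rat}.

Fixpoint splits (m : mon) : seq mon :=
  if m is x :: m' then [seq a :: s | a <- iota 0 x.+1, s <- splits m'] else [:: [::]].
Definition msub (m m1 : mon) : mon := [seq p.1 - p.2 | p <- zip m m1]%N.

Definition smul (k : comNzRingType) (f g : mon -> {poly k}) : mon -> {poly k} :=
  fun m => \sum_(m1 <- splits m) f m1 * g (msub m m1).
Definition sone (k : comNzRingType) : mon -> {poly k} :=
  fun m => if all (fun e => e == 0%N) m then 1 else 0.

(* Quasi-shuffle of weak compositions (as a multiset of words; all     *)
(* coefficients in a*b are sums of 1's).                               *)
Fixpoint qsh (a b : seq nat) : seq (seq nat) :=
  match a with
  | [::] => [:: b]
  | x :: a' =>
    let fix qsh_a (b : seq nat) : seq (seq nat) :=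
      match b with
      | [::] => [:: a]
      | y :: b' =>
          [seq x :: w | w <- qsh a' b] ++ [seq y :: w | w <- qsh_a b'] ++
          [seq (x + y)%N :: w | w <- qsh a' b']
      end in qsh_a b
  end.

Notation R := Rdefinitions.R.

(* prod_l x_(i_l)^(a_l) = x^m *)
Definition matches (a i : seq nat) (m : mon) : Prop :=
  forall p : nat, nth 0%N m p = (\sum_(l < size a) (nth 0%N i l == p.+1) * nth 0%N a l)%N.

Definition idx (a : seq nat) (m : mon) : set (seq nat) :=
  [set i | size i = size a /\ path ltn 0%N i /\ matches a i m].

(* coefficient of x^m in sum_{0<i_1<..<i_k} prod_l x_(i_l)^(a_l) e^((i_l+t) b_l z),
   as a function of real t and real z (all terms are positive). *)
Definition phi_val (a b : seq nat) (m : mon) (t z : R) : \bar R :=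
  (\esum_(i in idx a m)
     (expR (\sum_(l < size a) ((nth 0%N i l)%:R + t) * (nth 0%N b l)%:R * z))%:E)%E.

Definition is_laurent_exp (F : R -> R -> \bar R) (c : int -> {poly rat}) : Prop :=
  exists N : nat, (forall n : int, n < - (N%:Z) -> c n = 0) /\
    forall t : R, 0 <= t -> exists2 e : R, 0 < e &
      forall z : R, - e < z < 0 -> exists l : R, F t z = l%:E /\
        (fun J : nat => \sum_(j < J)
            (map_poly (@ratr R) (c (j%:Z - N%:Z))).[t] * z ^ (j%:Z - N%:Z)) @ \oo --> l.

Definition phi (a b : seq nat) : lser := fun m n =>
  match pselect (exists c, is_laurent_exp (phi_val a b m) c) with
  | left H => projT1 (cid H) n
  | right _ => 0
  end.

Definition lbound (F : lser) : nat :=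
  match pselect (exists N : nat, forall m n, n < - (N%:Z) -> F m n = 0) with
  | left H => projT1 (cid H)
  | right _ => 0%N
  end.

Definition lmul (F G : lser) : lser := fun m n =>
  let LF := lbound F in let LG := lbound G in
  match (n + LF%:Z + LG%:Z)%R with
  | Posz q => \sum_(m1 <- splits m) \sum_(j < q.+1)
                 F m1 (j%:Z - LF%:Z) * G (msub m m1) (n - (j%:Z - LF%:Z))
  | Negz _ => 0
  end.

Definition lsum (Fs : seq lser) : lser := fun m n => \sum_(F <- Fs) F m n.
Definition ladd (F G : lser) : lser := fun m n => F m n + G m n.
Definition lone : lser := fun m n => if n == 0 then sone rat m else 0.
Definition lpolar (F : lser) : lser := fun m n => if n < 0 then F m n else 0.
Definition lregular (F : lser) : lser := fun m n => if n < 0 then 0 else F m n.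
Definition lopp (F : lser) : lser := fun m n => - F m n.

Definition bar_phi (phim : seq nat -> seq nat -> lser) (a b : seq nat) : lser :=
  ladd (phi a b)
    (lsum [seq lmul (phi (take i a) (take i b)) (phim (drop i a) (drop i b))
          | i <- index_iota 1 (size a)]).

Fixpoint phi_minus_fuel (n : nat) (a b : seq nat) : lser :=
  match n with
  | 0 => lone
  | n'.+1 => lopp (lpolar (bar_phi (phi_minus_fuel n') a b))
  end.

Definition phi_minus (a b : seq nat) : lser := phi_minus_fuel (size a) a b.

Definition phi_plus (a b : seq nat) : lser :=
  lregular (bar_phi (phi_minus_fuel (size a).-1) a b).

Definition Zren (a b : seq nat) : qser := fun m => phi_plus a b m 0.

Definition Mren (delta : nat) (a : seq nat) : qser :=
  if a is [::] then sone rat else Zren a (nseq (size a) delta).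

Definition embed (k : comAlgType rat) (f : qser) : mon -> {poly k} :=
  fun m => map_poly (in_alg k) (f m).

Definition RenQSym (k : comAlgType rat) (delta : nat) : set (mon -> {poly k}) :=
  [set f | exists s : seq (k * seq nat),
     forall m, f m = \sum_(p <- s) p.1 *: embed k (Mren delta p.2) m].
Arguments RenQSym : clear implicits.

(* Main.v *)
Require Import Defs.
From HB Require Import structures.
From mathcomp Require Import all_boot all_order all_algebra.
From mathcomp Require Import all_classical all_reals all_analysis.
From mathcomp Require Import Rstruct Rstruct_topology.
From mathcomp Require Import ring lra zify.
Import Order.TTheory GRing.Theory Num.Theory.
Import numFieldNormedType.Exports.
Local Open Scope classical_set_scope.
Local Open Scope ring_scope.

Set Implicit Arguments.
Unset Strict Implicit.
Unset Printing Implicit Defensive.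

(** The coefficient of [x^m] in the sum defining [phi], for a word [a] whose second
    row is [delta, ..., delta], is a finite sum of exponentials times the
    elementary symmetric functions [T_r] of the alphabet [q^(i+t)], [i > p], with
    [q = e^(delta z)].  By Newton's identities the generating function of the
    [T_r] is [exp (sum_k (-1)^(k-1) u^k/k f_k)], where
    [f_k = q^(k(t+p+1)) / (1 - q^k) = - 1/(k delta z) - (t+p+1/2) + O(z)].
    Hence its Birkhoff counterterm is [exp (sum_k (-1)^(k-1) u^k / (k^2 delta z))],
    a purely polar series independent of [t], [p] and [X], and what remains at
    [z = 0] is [(1+u)^(-(t+p+1/2))].  Words containing a positive letter need no
    counterterm of their own.

    Consequently the coefficient of [x^m] in [M_a] is the value at
    [N = - (t + 1/2)] of the polynomial in [N] that counts, for large integers [N],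
    the increasing sequences in [1..N] realising [x^m].  For integers the
    quasi-shuffle rule is the ordinary product rule for monomial quasisymmetric
    polynomials in [N] variables, and a polynomial identity that holds at all
    natural numbers holds everywhere. *)

(** * The product rule in finitely many variables *)

Notation all0 := (all (fun e => e == 0%N)).

(** The binomial coefficient $\binom{c}{r}$ with an arbitrary field element on top. *)
Definition binr (K : fieldType) (c : K) (r : nat) : K :=
  (\prod_(i < r) (c - i%:R)) / r`!%:R.

(* For a natural number [c], [coefv c m a] is the coefficient of [x^m] in the
   monomial quasisymmetric polynomial of [a] in [size m + c] variables. *)
Fixpoint coefv (K : fieldType) (c : K) (m a : seq nat) : K :=
  match m with
  | [::] => if all0 a then binr c (size a) else 0
  | e :: m' => (e == 0%N)%:R * coefv c m' a +
      (if a is x :: a' then (e == x)%:R * coefv c m' a' else 0)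
  end.

Lemma qsh_cons x y a b : qsh (x :: a) (y :: b) =
  [seq x :: w | w <- qsh a (y :: b)] ++ [seq y :: w | w <- qsh (x :: a) b] ++
  [seq (x + y)%N :: w | w <- qsh a b].
Proof. by []. Qed.

Lemma qsh0l b : qsh [::] b = [:: b]. Proof. by []. Qed.

Lemma qsh0r a : qsh a [::] = [:: a]. Proof. by case: a. Qed.

Lemma splits_cons x m :
  splits (x :: m) = [seq i :: s | i <- iota 0 x.+1, s <- splits m].
Proof. by []. Qed.

Section Multiplicativity.
Variable K : numFieldType.
Implicit Types (c : K) (m a b : seq nat).

Definition qsh_mult c m := forall a b,
  \sum_(m1 <- splits m) coefv c m1 a * coefv c (msub m m1) b =
  \sum_(w <- qsh a b) coefv c m w.

Lemma sum_iota_indicators e x y :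
  \sum_(i <- iota 0 e.+1) ((i == x)%:R * ((e - i)%N == y)%:R) =
  (e == (x + y)%N)%:R :> K.
Proof.
have [lexe|ltex] := leqP x e.
  rewrite (bigD1_seq x) ?iota_uniq ?mem_iota //= big1 ?addr0 => [|i /negPf ->].
    by rewrite eqxx mul1r; congr (nat_of_bool _)%:R; lia.
  by rewrite mul0r.
rewrite big1_seq => [|i /andP[_]]; first by have /negPf -> : e != (x + y)%N by lia.
rewrite mem_iota => ?; have /negPf -> : i != x by lia.
by rewrite mul0r.
Qed.

Lemma qsh_mult_cons c e m : qsh_mult c m -> qsh_mult c (e :: m).
Proof.
move=> IH a b.
pose H a b := \sum_(w <- qsh a b) coefv c m w.
(* Here [x] and [y] are the exponents that the two words give to the leading variable ([0] for a
   word that skips it), and [u], [v] are what remains of the words. *)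
have step x y u v :
  \sum_(i <- iota 0 e.+1) \sum_(s <- splits m)
    ((i == x)%:R * coefv c s u) * (((e - i)%N == y)%:R * coefv c (msub m s) v) =
  (e == (x + y)%N)%:R * H u v.
  rewrite -sum_iota_indicators /H -IH mulr_suml; apply: eq_bigr => i _.
  by rewrite mulr_sumr; apply: eq_bigr => s _; rewrite mulrACA.
rewrite splits_cons big_allpairs_dep.
case: a b => [|x a] [|y b].
- transitivity ((e == (0 + 0)%N)%:R * H [::] [::]).
    rewrite -step; apply: eq_bigr => i _; apply: eq_bigr => s _ /=.
    by rewrite !addr0.
  by rewrite /H !qsh0l !big_seq1 /= addr0.
- transitivity ((e == (0 + 0)%N)%:R * H [::] (y :: b) + (e == (0 + y)%N)%:R * H [::] b).
    rewrite -!step -big_split; apply: eq_bigr => i _ /=; rewrite -big_split.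
    by apply: eq_bigr => s _ /=; rewrite addr0 mulrDr.
  by rewrite /H !qsh0l !big_seq1.
- transitivity ((e == (0 + 0)%N)%:R * H (x :: a) [::] + (e == (x + 0)%N)%:R * H a [::]).
    rewrite -!step -big_split; apply: eq_bigr => i _ /=; rewrite -big_split.
    by apply: eq_bigr => s _ /=; rewrite addr0 mulrDl.
  by rewrite !addn0 /H !qsh0r !big_seq1.
- transitivity ((e == (0 + 0)%N)%:R * H (x :: a) (y :: b) +
     (e == (0 + y)%N)%:R * H (x :: a) b + ((e == (x + 0)%N)%:R * H a (y :: b) +
     (e == (x + y)%N)%:R * H a b)).
    rewrite -!step -!big_split; apply: eq_bigr => i _ /=; rewrite -!big_split.
    by apply: eq_bigr => s _ /=; rewrite mulrDl !mulrDr.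
  rewrite !addn0 add0n /H qsh_cons !big_cat !big_map /= !big_split /= -!mulr_sumr.
  ring.
Qed.

Lemma binrS c r : r.+1%:R * binr c r.+1 = (c - r%:R) * binr c r.
Proof.
rewrite /binr big_ord_recr /= factS natrM invfM.
have : r.+1%:R != 0 :> K by rewrite pnatr_eq0.
have : r`!%:R != 0 :> K by rewrite pnatr_eq0 -lt0n fact_gt0.
by move: (r`!%:R : K) (r.+1%:R : K) => u v hu hv; field; rewrite hv hu.
Qed.

Lemma binr0 c : binr c 0 = 1.
Proof. by rewrite /binr big_ord0 fact0 invr1 mulr1. Qed.

Lemma binrSE c r : binr c r.+1 = (c - r%:R) * binr c r / r.+1%:R.
Proof. by rewrite -binrS mulrC mulKf ?pnatr_eq0. Qed.

Lemma binr_pascal c r : binr (c + 1) r.+1 = binr c r.+1 + binr c r.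
Proof.
elim: r => [|r IH].
  by rewrite !binrSE !binr0 invr1; ring.
rewrite binrSE IH (binrSE c r.+1) (binrSE c r).
have h1 : r.+1%:R != 0 :> K by rewrite pnatr_eq0.
have h2 : r.+2%:R != 0 :> K by rewrite pnatr_eq0.
move: h1 h2; rewrite -!natr1 => h1 h2; field; by rewrite h1 h2.
Qed.

(** One more free variable is a leading position of exponent [0], which a word of zeros may use or
    skip: this is Pascal's rule. *)
Lemma coefv_nil_succ c a : coefv (c + 1) [::] a = coefv c [:: 0%N] a.
Proof.
case: a => [|x a] /=; first by rewrite !binr0 mul1r addr0.
rewrite mul1r eq_sym; case: eqP => _ /=; last by rewrite mul0r addr0.
by case: (all0 a); rewrite ?binr_pascal ?mul1r ?addr0.
Qed.

(** Induction on the number of variables. With none, only the empty word survives; adding one turns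
    the empty monomial into [[:: 0]], where [qsh_mult_cons] applies. *)
Lemma qsh_mult_nil_nat (n : nat) : qsh_mult n%:R [::].
Proof.
have E c : qsh_mult c [::] <-> forall a b,
    coefv c [::] a * coefv c [::] b = \sum_(w <- qsh a b) coefv c [::] w.
  by split=> H a b; have := H a b; rewrite big_seq1.
elim: n => [|n IH].
  have c0 a : coefv (0 : K) [::] a = (a == [::])%:R.
    case: a => [|x a] /=; first by rewrite binr0.
    case: ifP => // _; by rewrite /binr big_ord_recl subr0 !mul0r.
  apply/E => a b; rewrite !c0.
  case: a b => [|x a] [|y b]; rewrite ?qsh0l ?qsh0r ?big_seq1 ?c0 ?mulr1 ?mulr0 //.
  under eq_bigr do rewrite c0.
  by rewrite qsh_cons !big_cat /= !big_map /= !big1_eq !addr0.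
apply/E => a b; rewrite -natr1 !coefv_nil_succ.
under eq_bigr do rewrite coefv_nil_succ.
by rewrite -(qsh_mult_cons 0 IH) big_seq1.
Qed.

Definition binp (r : nat) : {poly K} :=
  (r`!%:R^-1)%:P * \prod_(i < r) ('X - i%:R%:P).

Lemma horner_binp c r : (binp r).[c] = binr c r.
Proof.
rewrite /binp hornerM hornerC horner_prod mulrC; congr (_ * _).
by apply: eq_bigr => i _; rewrite hornerXsubC.
Qed.

Lemma poly_eq_nat (p q : {poly K}) : (forall n : nat, p.[n%:R] = q.[n%:R]) -> p = q.
Proof.
move=> H; apply/eqP; rewrite -subr_eq0; apply/negPn/negP => nz.
pose rs : seq K := [seq n%:R | n <- iota 0 (size (p - q))].
have : (size rs < size (p - q)%R)%N.
  apply: max_poly_roots nz _ _.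
    by apply/allP => _ /mapP [n _ ->]; rewrite rootE !hornerE H subrr.
  by rewrite map_inj_uniq ?iota_uniq // => x y /eqP; rewrite eqr_nat => /eqP.
by rewrite size_map size_iota ltnn.
Qed.

(** Since [qsh_mult_cons] keeps [c] fixed, only the empty monomial needs interpolation from natural
    [c]; there both sides are polynomials in [c]. *)
Lemma qsh_mult_all c m : qsh_mult c m.
Proof.
elim: m => [|e m IH]; last exact: qsh_mult_cons.
pose cp a := if all0 a then binp (size a) else 0.
have cpE x a : (cp a).[x] = coefv x [::] a.
  by rewrite /cp /=; case: ifP => _; rewrite ?horner_binp ?horner0.
move=> a b; rewrite big_seq1 -!cpE -hornerM.
under eq_bigr do rewrite -cpE; rewrite -horner_sum; congr horner.
apply: poly_eq_nat => n; rewrite hornerM horner_sum !cpE.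
under eq_bigr do rewrite cpE; rewrite -qsh_mult_nil_nat big_seq1 //.
Qed.

End Multiplicativity.

(** * Taylor expansions at 0 from the left *)

(** With fuel [k] the values below [k] have stabilised, so reading [n] off fuel [n.+1] solves the
    recursion. This yields the Bernoulli numbers and the counterterms. *)
Lemma strong_recursion (A : Type) (d : A) (F : nat -> (nat -> A) -> A) :
  (forall n f g, (forall i, (i < n)%N -> f i = g i) -> F n f = F n g) ->
  exists u : nat -> A, forall n, u n = F n u.
Proof.
move=> HF.
pose fu := fix fu k := if k is k'.+1 then fun n => F n (fu k') else fun _ => d.
have fuE k : forall n, (n < k)%N -> fu k n = fu n.+1 n.
  elim/ltn_ind: k => -[//|k] IH n nk /=; apply: HF => i i_n.
  by rewrite (IH k) // ?(IH n) // (leq_trans i_n).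
by exists (fun n => fu n.+1 n) => n; apply: HF => i; exact: fuE.
Qed.

Definition cauchyp (A : pzSemiRingType) (u v : nat -> A) (n : nat) : A :=
  \sum_(i < n.+1) u i * v (n - i)%N.

Section Taylor.
Variable K : realType.
Implicit Types (u v : nat -> K) (f g : K -> K) (z t C r : K) (n : nat).

(** Values are constrained only for $z<0$, the side on which the exponential sums converge. The
    geometric bound makes the notion stable under Cauchy products. *)
Definition tayl u f := exists C r, [/\ 0 < r, forall n, `|u n| <= C * r ^+ n &
  forall z, z < 0 -> `|z| * r < 1 -> series (fun n => u n * z ^+ n) @ \oo --> f z].

Lemma tayl_ext u v f g : u =1 v -> (forall z, z < 0 -> f z = g z) ->
  tayl u f -> tayl v g.
Proof.
move=> /funext <- fg [C [r [r0 ub uc]]]; exists C, r; split => // z z0 zr.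
by rewrite -fg //; exact: uc.
Qed.

Lemma coef_bound_ge0 u C r : 0 < r -> (forall n, `|u n| <= C * r ^+ n) -> 0 <= C.
Proof. by move=> r0 /(_ 0%N); rewrite expr0 mulr1; apply: le_trans. Qed.

Lemma tayl_common u v f g : tayl u f -> tayl v g ->
  exists C r, [/\ 0 < r, 0 <= C,
   (forall n, `|u n| <= C * r ^+ n) /\ (forall n, `|v n| <= C * r ^+ n),
   forall z, z < 0 -> `|z| * r < 1 -> series (fun n => u n * z ^+ n) @ \oo --> f z &
   forall z, z < 0 -> `|z| * r < 1 -> series (fun n => v n * z ^+ n) @ \oo --> g z].
Proof.
move=> [C [r [r0 ub uc]]] [D [s [s0 vb vc]]].
have C0 := coef_bound_ge0 r0 ub; have D0 := coef_bound_ge0 s0 vb.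
exists (C + D), (r + s).
have rs0 : 0 < r + s by rewrite addr_gt0.
split => //.
- exact: addr_ge0.
- split=> n; [apply: le_trans (ub n) _|apply: le_trans (vb n) _];
    apply: ler_pM; rewrite ?exprn_ge0 ?lerDl ?lerDr ?lerXn2r ?nnegrE ?lerDl ?lerDr //;
    by rewrite ltW.
- move=> z z0 zrs; apply: uc => //; apply: le_lt_trans zrs.
  by rewrite ler_wpM2l // lerDl ltW.
- move=> z z0 zrs; apply: vc => //; apply: le_lt_trans zrs.
  by rewrite ler_wpM2l // lerDr ltW.
Qed.

Lemma tayl_add u v f g : tayl u f -> tayl v g ->
  tayl (fun n => u n + v n) (fun z => f z + g z).
Proof.
move=> Hu Hv; have [C [r [r0 C0 [ub vb] uc vc]]] := tayl_common Hu Hv.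
exists (C + C), r; split => // [n|z z0 zr].
  by rewrite mulrDl (le_trans (ler_normD _ _)) // lerD.
rewrite (_ : series _ = series (fun n => u n * z ^+ n) \+ series (fun n => v n * z ^+ n)).
  by apply: cvgD; [exact: uc|exact: vc].
by apply/funext => n /=; rewrite /series /= -big_split; apply: eq_bigr => i _; rewrite mulrDl.
Qed.

Lemma tayl_scale u f t : tayl u f -> tayl (fun n => t * u n) (fun z => t * f z).
Proof.
move=> [C [r [r0 ub uc]]]; exists (`|t| * C), r; split => // [n|z z0 zr].
  by rewrite normrM -mulrA ler_wpM2l.
rewrite (_ : series _ = (fun n => t * series (fun n => u n * z ^+ n) n)).
  by apply: cvgM; [exact: cvg_cst|exact: uc].
by apply/funext => n /=; rewrite /series /= mulr_sumr; apply: eq_bigr => i _; rewrite mulrA.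
Qed.

Lemma tayl0 : tayl (fun=> 0) (fun=> 0).
Proof.
exists 0, 1; split => // [n|z _ _]; first by rewrite normr0 mul0r.
rewrite (_ : series _ = fun=> 0); first exact: cvg_cst.
by apply/funext => n; rewrite /series /= big1 // => i _; rewrite mul0r.
Qed.

Lemma tayl_shift u f : tayl u f ->
  tayl (fun n => if n is n'.+1 then u n' else 0) (fun z => z * f z).
Proof.
move=> [C [r [r0 ub uc]]]; have C0 := coef_bound_ge0 r0 ub.
exists (C / r), r; split => // [[|n]|z z0 zr].
- by rewrite normr0 expr0 mulr1 divr_ge0 // ltW.
- by rewrite exprS mulrA divfK ?gt_eqF.
rewrite -(cvg_shiftS (series _)) /=.
rewrite (_ : (fun n => _) = (fun n => z * series (fun n => u n * z ^+ n) n)).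
  by apply: cvgM; [exact: cvg_cst|exact: uc].
apply/funext => n /=; rewrite /series /= big_nat_recl //= mul0r add0r mulr_sumr.
by apply: eq_bigr => i _; rewrite exprS mulrCA.
Qed.

Lemma tayl_drop u f : tayl u f ->
  tayl (fun n => u n.+1) (fun z => (f z - u 0%N) / z).
Proof.
move=> [C [r [r0 ub uc]]].
exists (C * r), r; split => // [n|z z0 zr]; first by rewrite -mulrA -exprS.
rewrite (_ : series _ = (fun n => (series (fun n => u n * z ^+ n) n.+1 - u 0%N) * z^-1)).
  apply: cvgM; last exact: cvg_cst.
  apply: cvgB; last exact: cvg_cst.
  by rewrite (cvg_shiftS (series _)); exact: uc.
apply/funext => n /=; rewrite /series /= big_nat_recl //= expr0 mulr1 addrC addKr.
rewrite mulr_suml; apply: eq_bigr => i _.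
by rewrite exprSr mulrA mulfK // lt_eqF.
Qed.

(** For $|z|<1/(2r)$ the terms are dominated by a geometric series of ratio $1/2$. *)
Lemma tayl_bound u f : tayl u f ->
  exists B e, [/\ 0 < e & forall z, - e < z < 0 -> `|f z| <= B].
Proof.
move=> [C [r [r0 ub uc]]]; have C0 := coef_bound_ge0 r0 ub.
exists (C * 2), (2 * r)^-1; split; first by rewrite invr_gt0 mulr_gt0.
move=> z /andP[ez z0].
have zr : `|z| * r < 2^-1.
  by rewrite ltr0_norm // -ltr_pdivlMr // -invfM mulrC ltrNl mulrC.
have zr1 : `|z| * r < 1 by apply: lt_trans zr _; rewrite invf_lt1 ?ltr1n.
have H := uc z z0 zr1.
apply: (cvgr_to_le (cvg_norm H)); near=> n; rewrite /series /=.
apply: le_trans (ler_norm_sum _ _ _) _.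
apply: le_trans (_ : \sum_(0 <= i < n) C * (2^-1) ^+ i <= _).
  apply: ler_sum => i _; rewrite normrM normrX.
  apply: le_trans (_ : C * r ^+ i * `|z| ^+ i <= _); first by rewrite ler_wpM2r ?exprn_ge0.
  rewrite -mulrA -exprMn ler_wpM2l // lerXn2r ?nnegrE ?mulr_ge0 ?invr_ge0 ?(ltW r0) //.
  by rewrite mulrC ltW.
have -> : C * 2 = C * (1 - 2^-1)^-1 by congr (_ * _); field.
by apply: (geometric_le_lim n C0); rewrite ?invr_gt0 // ger0_norm ?invr_ge0 // invf_lt1 ?ltr1n.
Unshelve. all: by end_near.
Qed.

(** The quotient $(f(z)-u_0)/z$ has a Taylor expansion of its own, hence is bounded near $0$. *)
Lemma tayl_lim u f : tayl u f -> f z @[z --> 0^'-] --> u 0%N.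
Proof.
move=> Hu; have [B [e [e0 Hb]]] := tayl_bound (tayl_drop Hu).
have B0 : 0 <= B.
  apply: le_trans (Hb (- (e / 2)) _); first exact: normr_ge0.
  by rewrite ltrN2 oppr_lt0; apply/andP; split; lra.
apply/cvgrPdist_lt => /= eps eps0; near=> z.
have z0 : z < 0 by near: z; exact: nbhs_left_lt.
have ze : - e < z by near: z; apply: nbhs_left_gt; rewrite oppr_lt0.
have zeps : - (eps / (B + 1)) < z.
  by near: z; apply: nbhs_left_gt; rewrite oppr_lt0 divr_gt0 // ltr_wpDl.
have := Hb z; rewrite ze z0 => /(_ isT); rewrite normrM normfV distrC.
rewrite ler_pdivrMr ?normr_gt0 ?lt_eqF // => H; apply: le_lt_trans H _.
have B1 : 0 < B + 1 by rewrite ltr_wpDl.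
apply: le_lt_trans (_ : (B + 1) * `|z| < _); first by rewrite ler_wpM2r // lerDl.
by rewrite mulrC -ltr_pdivlMr // ltr0_norm // ltrNl.
Unshelve. all: by end_near.
Qed.

Lemma cauchyp_partial_sums u v n : \sum_(0 <= s < n) cauchyp u v s =
  \sum_(0 <= i < n) u i * \sum_(0 <= j < n - i) v j.
Proof.
elim: n => [|n IH]; first by rewrite !big_geq.
rewrite big_nat_recr //= IH [RHS]big_nat_recr //= subSnn big_nat1.
rewrite {1}/cauchyp big_ord_recr /= subnn addrA; congr (_ + _).
rewrite big_mkord [RHS]big_mkord -big_split; apply: eq_bigr => i _ /=.
by rewrite subSn ?(ltnW (ltn_ord i)) // big_nat_recr //= mulrDr.
Qed.

Lemma cauchyp_bound u v C r : 0 <= r -> 0 <= C ->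
  (forall n, `|u n| <= C * r ^+ n) -> (forall n, `|v n| <= C * r ^+ n) ->
  forall n, `|cauchyp u v n| <= n.+1%:R * (C * C * r ^+ n).
Proof.
move=> r0 C0 ub vb n; apply: le_trans (ler_norm_sum _ _ _) _.
rewrite mulr_natl -[X in _ *+ X]card_ord -sumr_const; apply: ler_sum => i _.
rewrite normrM -[in X in _ <= X](subnKC (leq_ord i)) exprD mulrACA.
by apply: ler_pM.
Qed.

(** The square partial sum exceeds the triangular one by at most $n^2$ terms, each bounded by
    $C^2r^n$. Using $n\le 2^n$ twice, $r<1/8$ leaves $C^22^{-n}$. The crude factor $8$ costs only a
    smaller interval around $0$. *)
Lemma cauchy_product_cvg u v (a b : K) C r : 0 <= r -> r * 8 < 1 -> 0 <= C ->
  (forall n, `|u n| <= C * r ^+ n) -> (forall n, `|v n| <= C * r ^+ n) ->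
  series u @ \oo --> a -> series v @ \oo --> b ->
  series (cauchyp u v) @ \oo --> a * b.
Proof.
move=> r0 r8 C0 ub vb ua vb'.
have r1 : r <= 1 by lra.
have D n : `|series u n * series v n - series (cauchyp u v) n| <= C * C * 2^-1 ^+ n.
  rewrite /series /= cauchyp_partial_sums mulr_suml -sumrB.
  apply: le_trans (ler_norm_sum _ _ _) _.
  apply: le_trans (_ : \sum_(0 <= i < n) (C * C * (n%:R * r ^+ n)) <= _).
    apply: ler_sum_nat => i /andP[_ /ltnW le_in]; rewrite -mulrBr normrM.
    have -> : \sum_(0 <= j < n) v j - \sum_(0 <= j < n - i) v j =
        \sum_(n - i <= j < n) v j.
      by rewrite (@big_cat_nat _ _ _ (n - i) 0 n) ?leq_subr //= addrAC subrr add0r.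
    apply: le_trans (_ : C * r ^+ i * (n%:R * (C * r ^+ (n - i))) <= _); last first.
      rewrite [r ^+ n in leRHS](_ : _ = r ^+ i * r ^+ (n - i)); last first.
        by rewrite -exprD subnKC.
      by rewrite le_eqVlt; apply/orP; left; apply/eqP; ring.
    apply: ler_pM => //; apply: le_trans (ler_norm_sum _ _ _) _.
    apply: le_trans (_ : \sum_(n - i <= j < n) C * r ^+ (n - i) <= _).
      apply: ler_sum_nat => j /andP[nij _]; apply: le_trans (vb j) _.
      by rewrite ler_wpM2l // ler_wiXn2l.
    rewrite sumr_const_nat subKn // -[leLHS]mulr_natl ler_wpM2r ?mulr_ge0 ?exprn_ge0 //.
    by rewrite ler_nat.
  rewrite sumr_const_nat subn0 -[leLHS]mulr_natl mulrCA ler_wpM2l ?mulr_ge0 //.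
  have n2 : (n <= 2 ^ n)%N by exact/ltnW/ltn_expl.
  have -> : 2^-1 ^+ n = (2 ^+ n) * (2 ^+ n * 8^-1 ^+ n) :> K.
    by rewrite -!exprMn; congr (_ ^+ _); field.
  apply: ler_pM; rewrite ?mulr_ge0 ?exprn_ge0 //; first by rewrite -natrX ler_nat.
  apply: ler_pM; rewrite ?exprn_ge0 //; first by rewrite -natrX ler_nat.
  by rewrite lerXn2r ?nnegrE ?invr_ge0 // -div1r ler_pdivlMr // ltW.
have D0 : (series u n * series v n - series (cauchyp u v) n) @[n --> \oo] --> 0.
  apply: norm_cvg0; apply: (@squeeze_cvgr _ _ _ _ (fun=> 0) (fun n => C * C * 2^-1 ^+ n)).
  - by near=> n; rewrite normr_ge0 D.
  - exact: cvg_cst.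
  - rewrite -[X in _ --> X](mulr0 (C * C)); apply: cvgM; first exact: cvg_cst.
    have := @cvg_geometric K 1 2^-1; rewrite /geometric /=.
    under eq_fun do rewrite mul1r; apply.
    by rewrite ger0_norm ?invr_ge0 // invf_lt1 ?ltr1n.
rewrite -[X in _ --> X]subr0.
rewrite (_ : series (cauchyp u v) = (fun n => series u n * series v n -
  (series u n * series v n - series (cauchyp u v) n))); last first.
  by apply/funext => n; rewrite subKr.
by apply: cvgB => //; exact: cvgM.
Unshelve. all: by end_near.
Qed.

Lemma tayl_mul u v f g : tayl u f -> tayl v g ->
  tayl (cauchyp u v) (fun z => f z * g z).
Proof.
move=> Hu Hv; have [C [r [r0 C0 [ub vb] uc vc]]] := tayl_common Hu Hv.
exists (C * C), (r * 8); split => // [|n|z z0 zr8]; first by rewrite mulr_gt0.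
  apply: le_trans (cauchyp_bound (ltW r0) C0 ub vb n) _.
  have -> : n.+1%:R * (C * C * r ^+ n) = C * C * (r ^+ n * n.+1%:R) by ring.
  rewrite exprMn ler_wpM2l ?mulr_ge0 // ler_wpM2l ?exprn_ge0 ?(ltW r0) //.
  apply: le_trans (_ : 2 ^+ n <= _); first by rewrite -natrX ler_nat ltn_expl.
  by rewrite lerXn2r ?nnegrE // ler_nat.
have zr : `|z| * r < 1.
  apply: le_lt_trans zr8; rewrite mulrA ler_peMr ?mulr_ge0 ?(ltW r0) //.
  by rewrite ler1n.
rewrite (_ : (fun n => _) =
  cauchyp (fun n => u n * z ^+ n) (fun n => v n * z ^+ n)); last first.
  apply/funext => n; rewrite /cauchyp mulr_suml; apply: eq_bigr => i _.
  by rewrite mulrACA -exprD subnKC // leq_ord.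
have bnd w : (forall n, `|w n| <= C * r ^+ n) ->
    forall n, `|w n * z ^+ n| <= C * (`|z| * r) ^+ n.
  move=> H n; rewrite normrM normrX exprMn (mulrC (`|z| ^+ n)) mulrA ler_wpM2r ?exprn_ge0 //.
apply: (cauchy_product_cvg _ _ C0 (bnd _ ub) (bnd _ vb)).
- by rewrite mulr_ge0 // ltW.
- by rewrite -mulrA.
- exact: uc.
- exact: vc.
Qed.

Lemma tayl_expR t : tayl (fun n => t ^+ n / n`!%:R) (fun z => expR (t * z)).
Proof.
exists 1, (`|t| + 1); split => [|n|z _ _]; first by rewrite ltr_wpDl.
  rewrite mul1r normrM normfV normrX normr_nat.
  rewrite ler_pdivrMr ?ltr0n ?fact_gt0 //.
  apply: le_trans (_ : (`|t| + 1) ^+ n * 1 <= _).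
    by rewrite mulr1 lerXn2r ?nnegrE ?addr_ge0 // lerDl.
  by rewrite ler_wpM2l ?exprn_ge0 ?addr_ge0 // ler1n fact_gt0.
rewrite (_ : (fun n => _) = exp_coeff (t * z)); first exact: is_cvg_series_exp_coeff.
by apply/funext => n; rewrite /exp_coeff /= exprMn mulrAC.
Qed.

Lemma tayl_dilate u f t : 0 < t -> tayl u f ->
  tayl (fun n => u n * t ^+ n) (fun z => f (t * z)).
Proof.
move=> t0 [C [r [r0 ub uc]]]; exists C, (r * t); split => [|n|z z0 zr].
- exact: mulr_gt0.
- by rewrite normrM exprMn mulrA normrX (gtr0_norm t0) ler_wpM2r ?exprn_ge0 // ltW.
rewrite (_ : (fun n => _) = (fun n => u n * (t * z) ^+ n)).
  apply: uc; first by rewrite pmulr_rlt0.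
  by rewrite normrM (gtr0_norm t0) mulrAC mulrC mulrCA mulrC -mulrA.
by apply/funext => n; rewrite exprMn mulrA.
Qed.

End Taylor.

(** * Laurent expansions *)

Section Laurent.
Variable K : realType.
Implicit Types (u v : nat -> K) (c : int -> K) (f g F G : K -> K) (z t : K) (n N : nat).

Lemma near_left0 (P : K -> Prop) : (\forall z \near 0^'-, P z) ->
  exists2 e : K, 0 < e & forall z, - e < z -> z < 0 -> P z.
Proof.
move=> /nbhs_ballP [e /= e0 H]; exists e => // z ez z0; apply: H => //.
by rewrite /ball /= sub0r normrN ltr0_norm // ltrNl.
Qed.

Lemma left0_near (P : K -> Prop) (e : K) : 0 < e ->
  (forall z, - e < z -> z < 0 -> P z) -> \forall z \near 0^'-, P z.
Proof.
move=> e0 H; near=> z; apply: H; last by near: z; exact: nbhs_left_lt.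
by near: z; apply: nbhs_left_gt; rewrite oppr_lt0.
Unshelve. all: by end_near.
Qed.

Lemma tayl_near_ext u f g : (\forall z \near 0^'-, f z = g z) ->
  tayl u f -> tayl u g.
Proof.
move=> /near_left0 [e e0 fg] Hu; have [C [r [r0 ub uc]]] := Hu.
have C0 := coef_bound_ge0 r0 ub; have ie0 : 0 < e^-1 by rewrite invr_gt0.
(* Adding [e^-1] to the rate forces $|z|<e$, where [f] and [g] agree. *)
exists C, (r + e^-1); split => [|n|z z0 zr]; first exact: addr_gt0.
  apply: le_trans (ub n) _; rewrite ler_wpM2l // lerXn2r ?nnegrE ?addr_ge0 ?(ltW r0) ?(ltW ie0) //.
  by rewrite lerDl ltW.
rewrite mulrDr in zr.
have zr1 : `|z| * r < 1 by apply: le_lt_trans zr; rewrite lerDl mulr_ge0 ?(ltW ie0).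
have zr2 : `|z| * e^-1 < 1 by apply: le_lt_trans zr; rewrite lerDr mulr_ge0 ?(ltW r0).
rewrite -fg //; first exact: uc.
by rewrite ltrNl -ltr0_norm // -[e]mul1r -ltr_pdivrMr.
Qed.

Lemma tayl_fun_unique u f g : tayl u f -> tayl u g ->
  \forall z \near 0^'-, f z = g z.
Proof.
move=> Hf Hg; have [C [r [r0 _ _ uf ug]]] := tayl_common Hf Hg.
apply: (@left0_near _ r^-1); rewrite ?invr_gt0 // => z rz z0.
have zr : `|z| * r < 1 by rewrite -ltr_pdivlMr // div1r ltr0_norm // ltrNl.
exact: (cvg_unique _ (uf z z0 zr) (ug z z0 zr)).
Qed.

Lemma tayl_of_bound u C r : 0 < r -> (forall n, `|u n| <= C * r ^+ n) ->
  tayl u (fun z => limn (series (fun n => u n * z ^+ n))).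
Proof.
move=> r0 ub; have C0 := coef_bound_ge0 r0 ub.
exists C, r; split => // z z0 zr; apply: normed_cvg.
apply: (@series_le_cvg _ _ (fun n => C * (`|z| * r) ^+ n)) => [n|n|n|].
- exact: normr_ge0.
- by rewrite mulr_ge0 ?exprn_ge0 ?mulr_ge0 // ltW.
- by rewrite /= normrM normrX exprMn (mulrC (`|z| ^+ n)) mulrA ler_wpM2r ?exprn_ge0.
- by apply: is_cvg_geometric_series; rewrite ger0_norm // mulr_ge0 // ltW.
Qed.

Lemma tayl_cst t : tayl (fun n => (n == 0%N)%:R * t) (fun=> t).
Proof.
apply: tayl_ext (tayl_scale t (tayl_expR 0)) => [n|z _].
  by case: n => [|n]; rewrite ?expr0 ?fact0 ?divr1 ?mul1r ?mulr1 // exprS !mul0r mulr0.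
by rewrite mul0r exp.expR0 mulr1.
Qed.

(** Here $b_n=B_n/n!$: the recursion is $\frac{e^z-1}{z}\sum_n b_nz^n=1$ read coefficientwise. *)
Lemma bernoulli_rec : exists b : nat -> rat, forall n,
  b n = (n == 0%N)%:R - \sum_(i < n) b i / ((n - i).+1)`!%:R.
Proof.
apply: (strong_recursion 0) => n f g fg; congr (_ - _).
by apply: eq_bigr => i _; rewrite fg.
Qed.

(** The recursion gives $|b_n|\le 2^n$, so the series has a sum; its Cauchy product with $(e^z-1)/z$
    is the series of $1$, which identifies that sum near $0$. *)
Lemma tayl_bernoulli : exists b : nat -> rat, [/\ b 0%N = 1, b 1%N = - 2^-1 &
  tayl (fun n => ratr (b n)) (fun z => z / (expR z - 1))].
Proof.
have [b bE] := bernoulli_rec; exists b.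
have b0 : b 0%N = 1 by rewrite bE big_ord0 subr0.
have b1 : b 1%N = - 2^-1 by rewrite bE big_ord1 b0 /= sub0r mul1r.
split => //.
have bb n : `|b n| <= 2 ^+ n.
  elim/ltn_ind: n => -[|n] IH; first by rewrite b0 normr1 expr0.
  rewrite bE sub0r normrN; apply: le_trans (ler_norm_sum _ _ _) _.
  apply: le_trans (_ : \sum_(i < n.+1) 2 ^+ i <= _).
    apply: ler_sum => i _; rewrite normrM normfV normr_nat.
    rewrite ler_pdivrMr ?ltr0n ?fact_gt0 //.
    apply: le_trans (IH i _) _ => //.
    by rewrite ler_peMr ?exprn_ge0 // ler1n fact_gt0.
  have /= := subrX1 (2 : rat) n.+1.
  by rewrite (_ : 2 - 1 = 1) // mul1r => <-; rewrite gerBl.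
have ub n : `|ratr (b n) : K| <= 1 * 2 ^+ n.
  by rewrite mul1r -(ratr_nat K 2) -rmorphXn -ratr_norm ler_rat; apply: bb.
have := @tayl_of_bound (fun n => ratr (b n)) 1 2 (ltr0n _ 2) ub.
move: (fun z => _) => B Hb.
have He := tayl_drop (tayl_expR (1 : K)).
have HBe := tayl_mul Hb He.
have H1 : tayl (fun n => (n == 0%N)%:R * 1) (fun z => B z * ((expR (1 * z) - 1 ^+ 0 / 0`!%:R) / z)).
  apply: tayl_ext HBe => // n; rewrite mulr1 /cauchyp.
  transitivity (ratr (\sum_(i < n.+1) b i / ((n - i).+1)`!%:R) : K).
    rewrite rmorph_sum; apply: eq_bigr => i _; rewrite expr1n mul1r.
    by rewrite /= rmorphM /= fmorphV /= ratr_nat.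
  by rewrite big_ord_recr /= subnn divr1 [b n]bE addrC subrK ratr_nat.
have [e e0 HH] := near_left0 (tayl_fun_unique H1 (tayl_cst 1)).
apply: tayl_near_ext Hb; apply: (left0_near e0) => z ez z0.
have e1 : expR z - 1 != 0 by rewrite subr_eq0 lt_eqF // expR_lt1.
have nz : z != 0 by rewrite lt_eqF.
have := HH z ez z0; rewrite mul1r expr0 fact0 divr1 => BE.
have -> : z / (expR z - 1) = B z * ((expR z - 1) / z) * (z / (expR z - 1)).
  by rewrite BE mul1r.
by field; rewrite nz e1.
Qed.

Definition lau c F := exists N, [/\ forall n : int, n < - N%:Z -> c n = 0 &
  tayl (fun j => c (j%:Z - N%:Z)) (fun z => z ^+ N * F z)].

Lemma lau_ext c c' F G : c =1 c' -> (forall z, z < 0 -> F z = G z) ->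
  lau c F -> lau c' G.
Proof.
move=> /funext <- FG [N [c0 H]]; exists N; split => //.
by apply: tayl_ext H => // z z0; rewrite FG.
Qed.

Lemma lau_lift c F N (M : nat) :
  (forall n : int, n < - N%:Z -> c n = 0) ->
  tayl (fun j => c (j%:Z - N%:Z)) (fun z => z ^+ N * F z) ->
  tayl (fun j => c (j%:Z - (M + N)%N%:Z)) (fun z => z ^+ (M + N)%N * F z).
Proof.
move=> c0 H; elim: M => // M IH.
apply: tayl_ext (tayl_shift IH) => [[|j]|z _].
- by rewrite c0 //; lia.
- by congr c; lia.
- by rewrite addSn exprS mulrA.
Qed.

Lemma lau_add c c' F G : lau c F -> lau c' G ->
  lau (fun n : int => c n + c' n) (fun z => F z + G z).
Proof.
move=> [N [c0 H]] [N' [c0' H']]; exists (N' + N)%N; split.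
  by move=> n n0; rewrite c0 ?c0' ?addr0 //; lia.
apply: tayl_ext (tayl_add (lau_lift N' c0 H) (lau_lift N c0' H')) => [j|z _].
  by rewrite (addnC N).
by rewrite (addnC N) mulrDr.
Qed.

Lemma lau_scale c F t : lau c F -> lau (fun n : int => t * c n) (fun z => t * F z).
Proof.
move=> [N [c0 H]]; exists N; split => [n n0|]; first by rewrite c0 ?mulr0.
by apply: tayl_ext (tayl_scale t H) => // z _; rewrite mulrCA.
Qed.

Lemma lau0 : lau (fun=> 0) (fun=> 0).
Proof.
by exists 0%N; split => //; apply: tayl_ext (tayl0 K) => // z _; rewrite mulr0.
Qed.

Lemma lau_sum (I : Type) (s : seq I) (c : I -> int -> K) (F : I -> K -> K) :
  (forall i, lau (c i) (F i)) ->
  lau (fun n : int => \sum_(i <- s) c i n) (fun z => \sum_(i <- s) F i z).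
Proof.
move=> H; elim: s => [|i s IH].
  by apply: lau_ext lau0 => [n|z _]; rewrite big_nil.
by apply: lau_ext (lau_add (H i) IH) => [n|z _]; rewrite big_cons.
Qed.

Lemma lau_shift c F (j : nat) : lau c F ->
  lau (fun n : int => c (n + j%:Z)) (fun z => z ^- j * F z).
Proof.
move=> [N [c0 H]]; exists (N + j)%N; split => [n n0|]; first by apply: c0; lia.
apply: tayl_ext H => [i|z z0]; first by congr c; lia.
by rewrite exprD -mulrA mulVKf // expf_neq0 // lt_eqF.
Qed.

Lemma cvg_expn_at_left0 N : z ^+ N.+1 @[z --> (0 : K)^'-] --> (0 : K).
Proof.
have z0 : z @[z --> (0 : K)^'-] --> (0 : K) by exact: cvg_at_left_filter.
elim: N => [|N IH]; first by under eq_fun do rewrite expr1.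
rewrite (_ : (fun z => z ^+ N.+2) = (fun z => z * z ^+ N.+1)).
  by have := cvgM z0 IH; rewrite mulr0; apply.
by apply/funext => z; rewrite exprS.
Qed.

(** Induction on the bound [N] for the pole order: a finite limit of $F$ makes $z^NF$ tend to $0$
    when $N>0$, so the coefficient of $z^{-N}$ vanishes and the bound drops by one. *)
Lemma lau_lim c F (L : K) : lau c F -> F z @[z --> 0^'-] --> L ->
  [/\ forall n : int, n < 0 -> c n = 0 & c 0 = L].
Proof.
move=> [N [c0 H]] FL.
elim: N c0 H => [|N IH] c0 H.
  split => [n n0|]; first by apply: c0; lia.
  have := tayl_lim H; rewrite (_ : (fun z => z ^+ 0 * F z) = F).
    by move=> cF; exact: (cvg_unique _ cF FL).
  by apply/funext => z; rewrite expr0 mul1r.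
have cN : c (- N.+1%:Z) = 0.
  have cF := tayl_lim H; rewrite sub0r in cF.
  have F0 := cvgM (cvg_expn_at_left0 N) FL; rewrite mul0r in F0.
  exact: (cvg_unique _ cF (F0 _)).
apply: IH => [n nN|].
  have [->|?] := eqVneq n (- N.+1%:Z); [exact: cN|apply: c0; lia].
apply: tayl_ext (tayl_drop H) => [j|z z0]; first by congr c; lia.
by rewrite sub0r cN subr0 exprSr mulrAC mulfK ?lt_eqF.
Qed.

(** The difference expands $0$, so [lau_lim] kills its coefficients of index at most $0$; one of
    index $n>0$ is first moved to index $0$ by dividing by $z^n$. *)
Lemma lau_unique c c' F : lau c F -> lau c' F -> c =1 c'.
Proof.
move=> Hc Hc' n.
have H : lau (fun n : int => c n + -1 * c' n) (fun=> 0).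
  by apply: lau_ext (lau_add Hc (lau_scale (-1) Hc')) => // z _; rewrite mulN1r subrr.
have lim0 : (0 : K) @[z --> (0 : K)^'-] --> (0 : K) by exact: cvg_cst.
have [n0|n0] := ltP n 0.
  by have [/(_ n n0) /eqP + _] := lau_lim H lim0; rewrite mulN1r subr_eq0 => /eqP.
have Hs : lau (fun k : int => c (k + `|n|%N%:Z) + -1 * c' (k + `|n|%N%:Z)) (fun=> 0).
  by apply: lau_ext (lau_shift `|n|%N H) => // z _; rewrite mulr0.
have [_] := lau_lim Hs lim0; rewrite add0r mulN1r gez0_abs // => /eqP.
by rewrite subr_eq0 => /eqP.
Qed.

End Laurent.

(** * Exponential sums over increasing sequences *)

Section IncreasingSums.
Local Open Scope nat_scope.

(** Positions are counted from $x_{p+1}$, so that an induction on the monomial can strip its first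
    variable by raising [p]. *)
Definition match_sum (p : nat) (a i : seq nat) (q : nat) : nat :=
  \sum_(l < size a) (nth 0 i l == (p + q).+1) * nth 0 a l.

Definition incr_idx (p : nat) (a m : seq nat) : set (seq nat) :=
  [set i | [/\ size i = size a, path ltn p i & forall q, nth 0 m q = match_sum p a i q]].

Definition incr_seqs (p r : nat) : set (seq nat) :=
  [set i | size i = r /\ path ltn p i].

Lemma idx_incr_idx a m : idx a m = incr_idx 0 a m.
Proof.
apply/seteqP; split => i /=.
  by move=> [? [? ?]]; split.
by move=> [? ? ?]; split.
Qed.

Lemma path_ltn_nth p i l : path ltn p i -> l < size i -> p < nth 0 i l.
Proof.
move=> /(order_path_min ltn_trans) /allP H ls.
by apply: H; rewrite mem_nth.
Qed.

Lemma match_sum_cons p x y a i q :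
  match_sum p (y :: a) (x :: i) q = (x == (p + q).+1) * y + match_sum p a i q.
Proof. by rewrite /match_sum big_ord_recl. Qed.

Lemma match_sum_shift p a i q : match_sum p a i q.+1 = match_sum p.+1 a i q.
Proof. by rewrite /match_sum addSnnS. Qed.

Lemma match_sum_first p a i : size i = size a -> path ltn p.+1 i ->
  match_sum p a i 0 = 0.
Proof.
move=> si pi; apply: big1 => l _; rewrite addn0.
have := path_ltn_nth pi; rewrite si => /(_ l (ltn_ord l)).
by case: eqP => // ->; rewrite ltnn.
Qed.

Lemma incr_idx_cons p a e m i : incr_idx p a (e :: m) i <->
  (e = 0 /\ incr_idx p.+1 a m i) \/
  exists a' i', [/\ a = e :: a', i = p.+1 :: i' & incr_idx p.+1 a' m i'].
Proof.
split=> [[si pi mi]|[[-> [si pi mi]]|[a' [i' [-> -> [si pi mi]]]]]].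
- have shift q : nth 0 m q = match_sum p.+1 a i q by rewrite -match_sum_shift -mi.
  case: i a si pi mi shift => [|x i] [|y a] // si pi mi shift.
    by left; split=> //; have := mi 0; rewrite /match_sum big_ord0.
  have /= /andP[px xi] := pi.
  move: px; rewrite leq_eqVlt => /orP[/eqP px|px].
    right; exists a, i; move: si => [si].
    have e_y : e = y.
      have := mi 0; rewrite match_sum_cons match_sum_first ?px //.
      by rewrite /= !addn0 -px eqxx mul1n.
    split; rewrite ?e_y ?px //; split; rewrite ?px // => q.
    by have := shift q; rewrite match_sum_cons -px; case: eqP => //; lia.
  left; have pi' : path ltn p.+1 (x :: i) by rewrite /= px.
  by split => //; have := mi 0; rewrite match_sum_first.
- split=> //; last by case=> [|q]; rewrite ?match_sum_first // match_sum_shift -mi.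
  by move: pi; case: (i) => //= x s /andP[/ltnW -> ->].
- split; rewrite /= ?si ?ltnSn //; case=> [|q]; rewrite match_sum_cons.
    by rewrite addn0 eqxx mul1n match_sum_first // addn0.
  by rewrite match_sum_shift -mi; case: eqP => //; lia.
Qed.

Lemma incr_idx_nil p a :
  incr_idx p a [::] = if all0 a then incr_seqs p (size a) else set0.
Proof.
case: ifP => a0; apply/seteqP; split => i //=.
- by move=> [].
- move=> [si pi]; split => // q; rewrite nth_nil /match_sum big1 // => l _.
  by rewrite (eqP (all_nthP 0 a0 l (ltn_ord l))) muln0.
- move=> [si pi mi]; move: a0 => /negbT /allPn [x /(nthP 0) [l la <-] al].
  have il : p < nth 0 i l by apply: path_ltn_nth; rewrite ?si.
  have := mi (nth 0 i l - p.+1); rewrite nth_nil /match_sum.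
  rewrite (bigD1 (Ordinal la)) //= (_ : _ == _ = true) ?mul1n.
    by move=> /esym/eqP; rewrite addn_eq0 (negPf al).
  by apply/eqP; lia.
Qed.

End IncreasingSums.

(** * Closed form of the exponential sums *)

Section ExponentialSums.
Variable K : realType.
Implicit Types (c s t : K) (p r : nat) (a m i : seq nat).

Definition wt s t (x : nat) : K := expR (s * (x%:R + t)).

(** With $q=e^s$ and $s<0$ this is $\sum_{0<i_1<\cdots<i_r}q^{i_1+\cdots+i_r}$. *)
Definition tail_cst s r : K :=
  \prod_(j < r) (expR (s * j.+1%:R) / (1 - expR (s * j.+1%:R))).

Definition tail_val s r t : K := expR (s * (r%:R * t)) * tail_cst s r.

(* Closed form of the sum over increasing sequences above [p] of the product of the weights
   [e^(s (i + t))], the positions [p+1, p+2, ..] having exponents [m]. *)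
Fixpoint exp_sum s t p m a : K :=
  match m with
  | [::] => if all0 a then tail_val s (size a) (p%:R + t) else 0
  | e :: m' => (e == 0%N)%:R * exp_sum s t p.+1 m' a +
      (if a is x :: a' then (e == x)%:R * (wt s t p.+1 * exp_sum s t p.+1 m' a')
       else 0)
  end.

Lemma wt_gt0 s t x : 0 < wt s t x. Proof. exact: expR_gt0. Qed.

Lemma esum_geometric c s : 0 <= c -> 0 <= s < 1 ->
  (\esum_(n in [set: nat]) (c * s ^+ n)%:E = (c * (1 - s)^-1)%:E)%E.
Proof.
move=> c0 /andP[s0 s1]; rewrite -nneseries_esumT; last first.
  by move=> n; rewrite lee_fin mulr_ge0 // exprn_ge0.
apply/cvg_lim => //.
rewrite (_ : (fun n => _) = EFin \o series (geometric c s)).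
  by apply: cvg_EFin; [near=> n|apply: cvg_geometric_series; rewrite ger0_norm].
by apply/funext => n; rewrite sumEFin.
Unshelve. all: by end_near.
Qed.

(** Induction on [r], splitting off the smallest index $p+n+1$: the sum over the other indices is
    known and leaves a geometric series in [n]. The free factor [c] absorbs the weight of that
    index. *)
Lemma esum_incr_seqs s t : s < 0 -> forall r p c, 0 <= c ->
  (\esum_(i in incr_seqs p r) (c * \prod_(x <- i) wt s t x)%:E =
   (c * tail_val s r (p%:R + t))%:E)%E.
Proof.
move=> s0; elim=> [|r IH] p c c0.
  rewrite (_ : incr_seqs p 0 = [set [::]]); last first.
    by apply/seteqP; split => i /=; [move=> [/size0nil -> _]|move=> ->].
  rewrite esum_set1 ?big_nil ?lee_fin ?mulr1 //.
  by rewrite /tail_val /tail_cst big_ord0 mul0r mulr0 exp.expR0 !mulr1.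
pose e (k : nat * seq nat) := (p + k.1).+1 :: k.2.
have bij : set_bij ([set: nat] `*`` (fun n => incr_seqs (p + n).+1 r))
    (incr_seqs p r.+1) e.
  split.
  - move=> [n i] /= [_ [si pi]]; split => /=; first by rewrite si.
    by rewrite pi andbT ltnS leq_addr.
  - by move=> [n i] [n' i'] _ _ [] nn ->; congr pair; lia.
  - move=> [|x i] [//= [si] /andP[px xi]]; exists ((x - p.+1)%N, i).
      by split => //; split => //=; rewrite -addSn subnKC.
    by rewrite /e /= -addSn subnKC.
rewrite (@reindex_esum _ _ _ _ _ e _ bij) -(@esum_esum _ _ _ _ _ (fun n i =>
  (c * \prod_(x <- (p + n).+1 :: i) wt s t x)%:E)); last first.
  move=> n i; rewrite lee_fin mulr_ge0 // big_seq prodr_ge0 // => x _.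
  exact/ltW/wt_gt0.
(* The ratio of the geometric series: raising all [r.+1] indices by one multiplies the product of
   weights by [g]. *)
pose g := expR (s * r.+1%:R).
have g01 : 0 <= g < 1.
  by rewrite expR_ge0 expR_lt1 pmulr_llt0 // ltr0n.
have tc0 : 0 <= tail_cst s r.
  apply: prodr_ge0 => j _; rewrite mulr_ge0 ?expR_ge0 // invr_ge0 subr_ge0.
  by rewrite expR_le1 mulr_le0_ge0 // ltW.
rewrite (eq_esum (b := fun n =>
  (c * (expR (s * (r.+1%:R * (p.+1%:R + t))) * tail_cst s r) * g ^+ n)%:E)).
  rewrite esum_geometric //; last by rewrite !mulr_ge0 ?expR_ge0.
  rewrite /tail_val /tail_cst big_ord_recr /= -/g; congr EFin.
  rewrite (_ : expR (s * (r.+1%:R * (p.+1%:R + t))) =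
    expR (s * (r.+1%:R * (p%:R + t))) * g); first by rewrite !mulrA; ring.
  by rewrite -exp.expRD; congr expR; rewrite -[p.+1%:R]natr1; ring.
move=> n _; rewrite (eq_esum (b := fun i =>
  (c * wt s t (p + n).+1 * \prod_(x <- i) wt s t x)%:E)); last first.
  by move=> i _; rewrite big_cons mulrA.
rewrite IH; last by rewrite mulr_ge0 // ltW // wt_gt0.
congr EFin.
rewrite -!mulrA; congr (_ * _); rewrite /tail_val /wt mulrA -exp.expRD.
rewrite (mulrC (tail_cst s r)) [RHS]mulrA /g -expRM_natr -exp.expRD; congr (expR _ * _).
by rewrite -addnS natrD -[r.+1%:R]natr1 -[n.+1%:R]natr1 -[p.+1%:R]natr1; ring.
Qed.

Lemma esum_incr_idx s t : s < 0 -> forall m a p c, 0 <= c ->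
  (\esum_(i in incr_idx p a m) (c * \prod_(x <- i) wt s t x)%:E =
   (c * exp_sum s t p m a)%:E)%E.
Proof.
move=> s0; elim=> [|e m IH] a p c c0.
  rewrite incr_idx_nil /=; case: (all0 a); first exact: esum_incr_seqs.
  by rewrite esum_set0 mulr0.
have ge0 i : (0 <= (c * \prod_(x <- i) wt s t x)%:E)%E.
  rewrite lee_fin mulr_ge0 // big_seq prodr_ge0 // => x _; exact/ltW/wt_gt0.
(* The split is by whether index [p.+1] occurs; the default head [0] puts the empty sequence among
   those that avoid it. *)
rewrite (esumID [set i | head 0%N i = p.+1]) //= mulrDr EFinD addeC.
congr (_ + _)%E.
- case: a => [|x a].
    rewrite mulr0 (_ : _ `&` _ = set0) ?esum_set0 //.
    apply/seteqP; split => i //= [/incr_idx_cons [[_ [/size0nil -> _ _]]|]] //.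
    by move=> [a' [i' []]].
  case: (eqVneq e x) => [<-|ex]; last first.
    rewrite mul0r mulr0 (_ : _ `&` _ = set0) ?esum_set0 //.
    apply/seteqP; split => i //= [/incr_idx_cons [[_ [_ pi _]]|]] //.
      by case: (i) pi => //= y s' /andP[py _] yp; rewrite yp ltnn in py.
    by move=> [a' [i' [[ex']]]]; rewrite ex' eqxx in ex.
  rewrite (_ : _ `&` _ = cons p.+1 @` incr_idx p.+1 a m).
    rewrite mul1r mulrA -IH ?(mulr_ge0 c0 (ltW (wt_gt0 s t p.+1))) // esum_image //.
      by apply: eq_esum => i _; rewrite big_cons mulrA.
    by move=> i i' _ _ [].
  apply/seteqP; split => i /=.
    move=> [/incr_idx_cons [[_ [_ pi _]]|]] //.
      by case: (i) pi => //= y s' /andP[py _] yp; rewrite yp ltnn in py.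
    by move=> [a' [i' [[<-] -> Hi]]] _; exists i'.
  move=> [i' Hi <-]; split => //; apply/incr_idx_cons; right.
  by exists a, i'.
- rewrite (_ : _ `&` _ = if e == 0%N then incr_idx p.+1 a m else set0).
    by case: eqP => _; rewrite ?esum_set0 ?mul0r ?mulr0 // mul1r IH.
  apply/seteqP; split => i /=.
    move=> [/incr_idx_cons [[-> Hi _] //|[a' [i' [_ -> _]]]]] //.
  case: eqP => // -> Hi; split; first by apply/incr_idx_cons; left.
  have [_ pi _] := Hi; case: (i) pi => //= x s' /andP[px _] xp.
  by rewrite xp ltnn in px.
Qed.

End ExponentialSums.

(** * Newton's identities *)

Section Convolution.
Variable A : comNzRingType.
Implicit Types (u v w p q : nat -> A).

Lemma cauchyp_last0 u v n : v 0%N = 0 ->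
  cauchyp u v n.+1 = \sum_(i < n.+1) u i * v (n - i).+1%N.
Proof.
move=> v0; rewrite /cauchyp big_ord_recr /= subnn v0 mulr0 addr0.
by apply: eq_bigr => i _; rewrite subSn // leq_ord.
Qed.

Lemma cauchypC u v n : cauchyp u v n = cauchyp v u n.
Proof.
rewrite /cauchyp (reindex_inj rev_ord_inj) /=; apply: eq_bigr => i _.
by rewrite subSS subKn ?leq_ord // mulrC.
Qed.

Lemma coef_cauchyp u v N n : (n < N)%N ->
  ((\poly_(i < N) u i) * (\poly_(i < N) v i))`_n = cauchyp u v n.
Proof.
move=> nN; rewrite coefM; apply: eq_bigr => i _; rewrite !coef_poly.
by rewrite !(leq_ltn_trans _ nN) ?leq_subr // leq_ord.
Qed.

(** Truncations at degree [n] are polynomials with the same coefficients up to [n], so associativity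
    is inherited from polynomial multiplication. *)
Lemma cauchypA u v w n : cauchyp u (cauchyp v w) n = cauchyp (cauchyp u v) w n.
Proof.
pose P x := \poly_(i < n.+1) (x i : A).
have low (x : {poly A}) y x' : (forall i, (i < n.+1)%N -> x`_i = x' i) ->
  (x * P y)`_n = cauchyp x' y n.
  move=> H; rewrite coefM; apply: eq_bigr => i _; rewrite H // coef_poly.
  by rewrite ltnS leq_subr.
rewrite -(low (P u * P v) w (cauchyp u v)); last by move=> i ?; rewrite /P coef_cauchyp.
rewrite cauchypC -(low (P v * P w) u (cauchyp v w)); last by move=> i ?; rewrite /P coef_cauchyp.
by rewrite mulrC mulrA.
Qed.

Lemma cauchypDr u v w n : cauchyp u (fun k => v k + w k) n = cauchyp u v n + cauchyp u w n.
Proof. by rewrite -big_split; apply: eq_bigr => i _; rewrite mulrDr. Qed.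

Lemma cauchyp_leibniz u v n : n%:R * cauchyp u v n =
  cauchyp (fun k => k%:R * u k) v n + cauchyp u (fun k => k%:R * v k) n.
Proof.
rewrite mulr_sumr -big_split; apply: eq_bigr => i _ /=.
have -> : n%:R = i%:R + (n - i)%:R :> A by rewrite -natrD subnKC // leq_ord.
ring.
Qed.

(* Newton's identity [n u_n = sum_k u_(n-k) p_k] says that the generating
   function of [u] has logarithmic derivative [sum_k p_k X^(k-1)]; hence it is
   additive in [p] along products. *)
Lemma cauchyp_newton u v p q : (forall n, n%:R * u n = cauchyp u p n) ->
  (forall n, n%:R * v n = cauchyp v q n) ->
  forall n, n%:R * cauchyp u v n = cauchyp (cauchyp u v) (fun k => p k + q k) n.
Proof.
move=> Hu Hv n; rewrite cauchyp_leibniz cauchypDr (funext Hu) (funext Hv) cauchypA.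
congr (_ + _).
have cC (x y : nat -> A) : cauchyp x y = cauchyp y x.
  by apply/funext => k; exact: cauchypC.
by rewrite cauchypC cauchypA (cC v u).
Qed.

End Convolution.

Section QNewton.
Variables (F : fieldType) (x : F).
Hypothesis x_nroot : forall n, x ^+ n.+1 != 1.

Definition qprod r : F := \prod_(j < r) (x ^+ j.+1 / (1 - x ^+ j.+1)).

(** The signed power sum $(-1)^{n-1}p_n$ of the alphabet $x,x^2,\dots$; with these signs, and the
    value [0] at [0], Newton's identity is a plain Cauchy product. *)
Definition qpow n : F :=
  if n is k.+1 then (-1) ^+ k * (x ^+ n / (1 - x ^+ n)) else 0.

Lemma subr1X_neq0 n : 1 - x ^+ n.+1 != 0.
Proof. by rewrite subr_eq0 eq_sym x_nroot. Qed.

Lemma qprodS r : (1 - x ^+ r.+1) * qprod r.+1 = x ^+ r.+1 * qprod r.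
Proof.
rewrite /qprod big_ord_recr /= mulrCA mulrC; congr (_ * _).
by rewrite mulrCA divff ?mulr1 // subr1X_neq0.
Qed.

Lemma qpow_shift k : x ^+ k.+1 * (qpow k.+1 + (-1) ^+ k) = qpow k.+1.
Proof. by rewrite /qpow; field; exact: subr1X_neq0. Qed.

Lemma qpowS k : (1 - x ^+ k.+1) * qpow k.+1 = (-1) ^+ k * x ^+ k.+1.
Proof. by rewrite /qpow; field; exact: subr1X_neq0. Qed.

(* The power sums of the alphabet [x, x^2, ..] are [x^k / (1 - x^k)] and its
   elementary symmetric functions are [qprod]. *)
Lemma qprod_newton n : n%:R * qprod n = cauchyp qprod qpow n.
Proof.
elim: n => [|m IH]; first by rewrite /cauchyp big_ord1 mul0r mulr0.
apply: (mulfI (subr1X_neq0 m)); rewrite mulrCA qprodS.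
(* Splitting $1-x^{m+1}=(1-x^i)+x^i(1-x^{m+1-i})$ prepares the first part for [qprodS] and the
   second for [qpowS]. *)
have -> : (1 - x ^+ m.+1) * cauchyp qprod qpow m.+1 =
    (\sum_(i < m.+1) (1 - x ^+ i) * qprod i * qpow (m.+1 - i)) +
    \sum_(i < m.+1) x ^+ m.+1 * ((-1) ^+ (m - i) * qprod i).
  rewrite /cauchyp big_ord_recr /= subnn mulr0 addr0 mulr_sumr -big_split.
  apply: eq_bigr => i _ /=.
  have := qpowS (m - i); rewrite -subSn ?leq_ord // => Hq.
  have -> : x ^+ m.+1 = x ^+ i * x ^+ (m.+1 - i).
    by rewrite -exprD subnKC // leqW // leq_ord.
  have -> : (-1) ^+ (m - i) * qprod i = qprod i * (-1) ^+ (m - i) by rewrite mulrC.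
  transitivity ((1 - x ^+ i) * qprod i * qpow (m.+1 - i) +
    x ^+ i * qprod i * ((1 - x ^+ (m.+1 - i)) * qpow (m.+1 - i))); first by ring.
  by rewrite Hq; ring.
rewrite big_ord_recl /= expr0 subrr !mul0r add0r.
(* [qprodS] lowers the index and [qpow_shift] completes the power to $x^{m+1}$. The signed terms
   then cancel the second sum except for its last term, and the induction hypothesis gives the
   rest. *)
have -> : \sum_(i < m) (1 - x ^+ bump 0 i) * qprod (bump 0 i) * qpow (m.+1 - bump 0 i)
    = \sum_(i < m) x ^+ m.+1 * (qprod i * qpow (m - i) - (-1) ^+ (m - i) * qprod i).
  apply: eq_bigr => i _; rewrite /bump /= add1n subSS qprodS.
  have [k km] : exists k, (m - i = k.+1)%N by exists (m - i).-1; have := ltn_ord i; lia.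
  rewrite km -{1}qpow_shift (_ : m.+1 = (i.+1 + k.+1)%N); last by lia.
  by rewrite exprD (exprS (-1) k); ring.
rewrite -[in RHS]mulr_sumr [in RHS]big_ord_recr /= subnn -mulr_sumr sumrB.
rewrite -natr1; have := IH; rewrite {1}/cauchyp big_ord_recr /= subnn mulr0 addr0 => <-.
by ring.
Qed.

End QNewton.

(** * The counterterm and the renormalised tail *)

Section CounterTerm.
Variable delta : nat.

(** Newton's identity for the signed power sums $(-1)^{k-1}/(k\delta z)$, which are opposite to the
    poles of those of the tail; ['X] stands for $1/z$. *)
Lemma counter_rec : exists C : nat -> {poly rat}, forall n,
  C n = if n is n'.+1 then n%:R^-1 *: ('X * \sum_(k < n)
    ((-1) ^+ (n' - k) / ((n' - k).+1%:R * delta%:R)) *: C k) else 1.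
Proof.
apply: (strong_recursion 0) => -[//|n] f g fg; congr (_ *: (_ * _)).
by apply: eq_bigr => k _; rewrite fg.
Qed.

(* [(counter r).[1/z]] is the coefficient of [u^r] in
   [exp (sum_k (-1)^(k-1) u^k / (k^2 delta z))]. *)
Definition counter : nat -> {poly rat} := projT1 (cid counter_rec).

Lemma counterE n :
  counter n = if n is n'.+1 then n%:R^-1 *: ('X * \sum_(k < n)
    ((-1) ^+ (n' - k) / ((n' - k).+1%:R * delta%:R)) *: counter k) else 1.
Proof. by rewrite /counter; case: cid => C /= ->. Qed.

Lemma counter0 : counter 0 = 1.
Proof. by rewrite counterE. Qed.

Lemma counterS_coef0 n : (counter n.+1)`_0 = 0.
Proof. by rewrite counterE coefZ coefXM mulr0. Qed.

End CounterTerm.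

Section Evaluation.
Variable K : realType.
Implicit Types (t : K) (p q : {poly rat}).

Definition evp t p : K := (map_poly (@ratr K) p).[t].

Lemma evpD t p q : evp t (p + q) = evp t p + evp t q.
Proof. by rewrite /evp rmorphD hornerD. Qed.

Lemma evpM t p q : evp t (p * q) = evp t p * evp t q.
Proof. by rewrite /evp rmorphM hornerM. Qed.

Lemma evp0 t : evp t 0 = 0.
Proof. by rewrite /evp rmorph0 horner0. Qed.

Lemma evp1 t : evp t 1 = 1.
Proof. by rewrite /evp rmorph1 hornerC. Qed.

Lemma evpC t (x : rat) : evp t x%:P = ratr x.
Proof. by rewrite /evp map_polyC hornerC. Qed.

Lemma evpX t : evp t 'X = t.
Proof. by rewrite /evp map_polyX hornerX. Qed.

Lemma evpZ t (x : rat) p : evp t (x *: p) = ratr x * evp t p.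
Proof. by rewrite -mul_polyC evpM evpC. Qed.

Lemma evp_exp t p n : evp t (p ^+ n) = evp t p ^+ n.
Proof. by elim: n => [|n IH]; rewrite ?expr0 ?evp1 // !exprS evpM IH. Qed.

Lemma evp_sum t (I : Type) (s : seq I) (P : pred I) (F : I -> {poly rat}) :
  evp t (\sum_(i <- s | P i) F i) = \sum_(i <- s | P i) evp t (F i).
Proof. exact: (big_morph _ (evpD t) (evp0 t)). Qed.

(** Natural values of $t$ lie in the range $t\ge0$ where the expansions are specified, and they
    determine a coefficient in $\mathbb Q[t]$. *)
Lemma evp_nat_inj p q : (forall n : nat, evp n%:R p = evp n%:R q) -> p = q.
Proof.
move=> H; apply: (@map_poly_inj _ _ (@ratr K)).
exact: poly_eq_nat.
Qed.

End Evaluation.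

(** * Limit of the renormalised tail at $z=0$ *)

Section TailLimit.
Variables (K : realType) (delta : nat).
Hypothesis delta_gt0 : (0 < delta)%N.
Implicit Types (s t z : K).

Lemma tail_cstE s r : tail_cst s r = qprod (expR s) r.
Proof. by apply: eq_bigr => j _; rewrite expRM_natr. Qed.

Definition tail_pow s t (k : nat) : K := expR (s * (k%:R * t)) * qpow (expR s) k.

Definition pole_pow z (k : nat) : K :=
  if k is k'.+1 then (-1) ^+ k' / (k%:R * delta%:R * z) else 0.

(** The coefficient of $u^r$ in the product of the generating functions of the tail and of the
    counterterm. *)
Definition reg_tail z t (r : nat) : K :=
  cauchyp (fun j => tail_val (delta%:R * z) j t)
    (fun j => evp z^-1 (counter delta j)) r.

(** Shifting the alphabet by [t] rescales degree [n] by $e^{snt}$, which is compatible with Cauchy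
    products. *)
Lemma tail_newton s t n : s < 0 ->
  n%:R * tail_val s n t = cauchyp (fun j => tail_val s j t) (tail_pow s t) n.
Proof.
move=> s0; have nroot k : expR s ^+ k.+1 != 1.
  by rewrite -expRM_natr lt_eqF // expR_lt1 nmulr_rlt0.
rewrite /tail_val tail_cstE mulrCA (qprod_newton nroot) mulr_sumr.
apply: eq_bigr => i _; rewrite tail_cstE /tail_pow mulrACA -exp.expRD.
by congr (expR _ * _); rewrite -mulrDr -mulrDl -natrD subnKC // leq_ord.
Qed.

Lemma counter_newton z n :
  n%:R * evp z^-1 (counter delta n) =
  cauchyp (fun j => evp z^-1 (counter delta j)) (pole_pow z) n.
Proof.
case: n => [|n]; first by rewrite mul0r /cauchyp big_ord1 /pole_pow mulr0.
rewrite {1}counterE evpZ evpM evpX evp_sum fmorphV /= ratr_nat mulVKf ?pnatr_eq0 //.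
rewrite cauchyp_last0 // mulr_sumr; apply: eq_bigr => i _.
rewrite evpZ /pole_pow fmorph_div /= rmorphXn /= rmorphN1 rmorphM /= !ratr_nat.
by rewrite !invfM; ring.
Qed.

Lemma near_left0_cvg (f g : K -> K) (l : K) : (forall z, z < 0 -> f z = g z) ->
  f z @[z --> (0 : K)^'-] --> l -> g z @[z --> (0 : K)^'-] --> l.
Proof.
move=> fg; apply: cvg_trans; apply: near_eq_cvg; near=> z; apply: fg.
by near: z; exact: nbhs_left_lt.
Unshelve. all: by end_near.
Qed.

(* With [y = k delta z], the sum of [k]-th power sums is, up to sign,
   [exp (t y) e^y / (1 - e^y) + 1 / y]: the pole cancels. *)
Lemma reg_pow_lim t k :
  (tail_pow (delta%:R * z) t k.+1 + pole_pow z k.+1) @[z --> (0 : K)^'-] -->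
  (-1) ^+ k * (- (t + 2^-1)).
Proof.
have [b [b0 b1 Hb]] := tayl_bernoulli K.
have kd0 : 0 < k.+1%:R * delta%:R :> K by rewrite mulr_gt0 // ltr0n.
(* As $y\to0$, $(e^{(1+t)y}\,y/(e^y-1)-1)/y$ tends to the linear Taylor coefficient $(1+t)-1/2$ of
   the product. *)
have := tayl_lim (tayl_dilate kd0 (tayl_drop (tayl_mul (tayl_expR (1 + t)) Hb))).
rewrite expr0 mulr1; set u := cauchyp _ _.
have -> : u 0%N = 1.
  by rewrite /u /cauchyp big_ord1 subnn b0 expr0 fact0 divr1 rmorph1 mulr1.
have -> : u 1%N = t + 2^-1.
  have r1 : ratr 1 = 1 :> K by exact: rmorph1.
  have r2 : ratr (- 2^-1) = - 2^-1 :> K by rewrite rmorphN /= fmorphV /= ratr_nat.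
  rewrite /u /cauchyp !big_ord_recl big_ord0 /= b0 b1 r1 r2 /bump /= !expr0 !divr1 expr1.
  by field.
move=> H; rewrite mulrN -mulNr.
have cs : - (-1) ^+ k @[z --> (0 : K)^'-] --> (- (-1) ^+ k : K) by exact: cvg_cst.
apply: near_left0_cvg (cvgM cs H) => z z0.
have d0 : delta%:R != 0 :> K by rewrite pnatr_eq0 -lt0n.
have k0 : k.+1%:R != 0 :> K by rewrite pnatr_eq0.
have zn0 : z != 0 by rewrite lt_eqF.
set y := k.+1%:R * delta%:R * z.
have y0 : y < 0 by rewrite pmulr_rlt0.
rewrite /tail_pow /pole_pow /qpow -/y -expRM_natr.
have -> : delta%:R * z * k.+1%:R = y by rewrite /y; ring.
have -> : delta%:R * z * (k.+1%:R * t) = t * y by rewrite /y; ring.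
rewrite (_ : (1 + t) * y = y + t * y) ?exp.expRD; last by ring.
have e1 : expR y - 1 != 0 by rewrite subr_eq0 lt_eqF // expR_lt1.
have e2 : 1 - expR y != 0 by rewrite subr_eq0 gt_eqF // expR_lt1.
have yn0 : y != 0 by rewrite lt_eqF.
move: e1 e2 yn0; move: (expR y) (expR (t * y)) => X T.
by rewrite /y => *; field; do ! (apply/andP; split).
Qed.

(** Newton's identity for $(1+u)^c$, whose signed power sums are $(-1)^{k-1}c$. *)
Lemma binr_newton (c : K) n :
  n.+1%:R * binr c n.+1 = \sum_(i < n.+1) binr c i * ((-1) ^+ (n - i) * c).
Proof.
elim: n => [|n IH]; first by rewrite binrS big_ord1 subnn expr0 binr0 subr0 mul1r mulr1 mul1r.
rewrite binrS mulrBl IH [RHS]big_ord_recr /= subnn expr0 mul1r [RHS]addrC (mulrC c); congr (_ + _).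
by rewrite -sumrN; apply: eq_bigr => i _; rewrite subSn ?leq_ord // exprS; ring.
Qed.

Lemma reg_tail_newton z t n : z < 0 -> reg_tail z t n.+1 =
  n.+1%:R^-1 * \sum_(i < n.+1) reg_tail z t i *
    (tail_pow (delta%:R * z) t (n - i).+1 + pole_pow z (n - i).+1).
Proof.
move=> z0; have dz : delta%:R * z < 0 by rewrite pmulr_rlt0 // ltr0n.
have := cauchyp_newton (fun j => tail_newton t j dz) (counter_newton z) n.+1.
rewrite [X in _ = X]cauchyp_last0; last by rewrite /tail_pow /= mulr0 addr0.
by move=> H; apply: (mulfI (_ : n.+1%:R != 0)); rewrite ?pnatr_eq0 // mulVKf ?pnatr_eq0.
Qed.

(** Newton's identity expresses each coefficient through earlier ones and the power sums. The latter
    converge by [reg_pow_lim], so the limits obey the recursion of [binr_newton] with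
    $c=-(t+1/2)$. *)
Lemma reg_tail_lim t r : reg_tail z t r @[z --> (0 : K)^'-] --> binr (- (t + 2^-1)) r.
Proof.
elim/ltn_ind: r => -[_|n IH].
  rewrite binr0; apply: near_left0_cvg (cvg_cst (1 : K)) => z z0.
  rewrite /reg_tail /cauchyp big_ord1 counter0 evp1 mulr1 /tail_val.
  by rewrite /tail_cst big_ord0 mul0r mulr0 exp.expR0 mulr1.
have -> : binr (- (t + 2^-1)) n.+1 = n.+1%:R^-1 * \sum_(i < n.+1)
    binr (- (t + 2^-1)) i * ((-1) ^+ (n - i) * - (t + 2^-1)).
  by rewrite -binr_newton mulKf ?pnatr_eq0.
apply: (@near_left0_cvg (fun z => n.+1%:R^-1 * \sum_(i < n.+1) reg_tail z t i *
    (tail_pow (delta%:R * z) t (n - i).+1 + pole_pow z (n - i).+1))).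
  by move=> z z0; rewrite -reg_tail_newton.
apply: cvgM; first exact: cvg_cst.
apply: (cvg_big (op := +%R)) => [|i _]; first exact: add_continuous.
by apply: cvgM; [exact: IH|exact: reg_pow_lim].
Qed.

End TailLimit.

(** * The expansion of [phi] *)

Section PolynomialTaylor.
Variables (K : realType) (delta : nat).
Hypothesis delta_gt0 : (0 < delta)%N.
Implicit Types (u v : nat -> {poly rat}) (f g : K -> K -> K) (t z : K).

(** The coefficients are rational polynomials in $t$; the radius of convergence may vary with
    $t$. *)
Definition ptayl u f := forall t, tayl (fun n => evp t (u n)) (f t).

Lemma ptayl_ext u f g : (forall t z, z < 0 -> f t z = g t z) -> ptayl u f -> ptayl u g.
Proof. by move=> fg H t; apply: tayl_ext (H t) => // z; exact: fg. Qed.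

Lemma ptayl_add u v f g : ptayl u f -> ptayl v g ->
  ptayl (fun n => u n + v n) (fun t z => f t z + g t z).
Proof. by move=> Hu Hv t; apply: tayl_ext (tayl_add (Hu t) (Hv t)) => // n; rewrite evpD. Qed.

Lemma ptayl_mul u v f g : ptayl u f -> ptayl v g ->
  ptayl (cauchyp u v) (fun t z => f t z * g t z).
Proof.
move=> Hu Hv t; apply: tayl_ext (tayl_mul (Hu t) (Hv t)) => // n.
by rewrite evp_sum; apply: eq_bigr => i _; rewrite evpM.
Qed.

Lemma ptayl_scale u f (x : rat) : ptayl u f ->
  ptayl (fun n => x *: u n) (fun t z => ratr x * f t z).
Proof. by move=> H t; apply: tayl_ext (tayl_scale _ (H t)) => // n; rewrite evpZ. Qed.

Lemma ptayl_shift u f : ptayl u f ->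
  ptayl (fun n => if n is n'.+1 then u n' else 0) (fun t z => z * f t z).
Proof.
by move=> H t; apply: tayl_ext (tayl_shift (H t)) => // -[|n]; rewrite ?evp0.
Qed.

Lemma ptayl_expR (p : {poly rat}) :
  ptayl (fun n => n`!%:R^-1 *: p ^+ n) (fun t z => expR (evp t p * z)).
Proof.
move=> t; apply: tayl_ext (tayl_expR (evp t p)) => // n.
by rewrite evpZ fmorphV /= ratr_nat evp_exp mulrC.
Qed.

Lemma ptayl_geometric k : exists u,
  ptayl u (fun _ z => z * (expR (delta%:R * z * k.+1%:R) /
                          (1 - expR (delta%:R * z * k.+1%:R)))).
Proof.
have [b [_ _ Hb]] := tayl_bernoulli K.
have [y yE] : exists y : rat, ratr y = k.+1%:R * delta%:R :> K.
  by exists (k.+1%:R * delta%:R); rewrite rmorphM /= !ratr_nat.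
have y0 : 0 < ratr y :> K by rewrite yE mulr_gt0 // ltr0n.
have HB : ptayl (fun n => (b n * y ^+ n)%:P)
    (fun _ z => ratr y * z / (expR (ratr y * z) - 1)).
  move=> t; apply: tayl_ext (tayl_dilate y0 Hb) => // n.
  by rewrite evpC rmorphM /= rmorphXn.
exists (fun n => - y^-1 *: cauchyp (fun n => n`!%:R^-1 *: y%:P ^+ n)
  (fun n => (b n * y ^+ n)%:P) n).
apply: ptayl_ext (ptayl_scale (- y^-1) (ptayl_mul (ptayl_expR y%:P) HB)) => t z z0.
rewrite evpC rmorphN /= fmorphV /=.
have -> : delta%:R * z * k.+1%:R = ratr y * z by rewrite yE; ring.
have yz : ratr y * z < 0 by rewrite pmulr_rlt0.
have e1 : expR (ratr y * z) - 1 != 0 by rewrite subr_eq0 lt_eqF // expR_lt1.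
have e2 : 1 - expR (ratr y * z) != 0 by rewrite subr_eq0 gt_eqF // expR_lt1.
have yn0 : ratr y != 0 :> K by rewrite gt_eqF.
by move: e1 e2; move: (expR _) => X e1 e2; field; rewrite yn0 e1 e2.
Qed.

Lemma ptayl_tail_cst r : exists u,
  ptayl u (fun _ z => z ^+ r * tail_cst (delta%:R * z) r).
Proof.
elim: r => [|r [u Hu]].
  exists (fun n => n`!%:R^-1 *: 0 ^+ n); apply: ptayl_ext (ptayl_expR 0) => t z _.
  by rewrite evp0 mul0r exp.expR0 /tail_cst big_ord0 mulr1.
have [v Hv] := ptayl_geometric r; exists (cauchyp u v).
apply: ptayl_ext (ptayl_mul Hu Hv) => t z _.
by rewrite /tail_cst big_ord_recr /= exprSr mulrACA.
Qed.

(* A sum over sequences matched to [a] has a pole of order at most [size a]. *)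
Lemma ptayl_exp_sum m a p : exists u,
  ptayl u (fun t z => z ^+ size a * exp_sum (delta%:R * z) t p m a).
Proof.
have zero : ptayl (fun=> 0) (fun _ _ => 0).
  by move=> t; apply: tayl_ext (tayl0 K) => // n; rewrite evp0.
elim: m a p => [|e m IH] a p.
  rewrite /=; case: (all0 a); last first.
    by exists (fun=> 0); apply: ptayl_ext zero => t z _; rewrite mulr0.
  have [u Hu] := ptayl_tail_cst (size a).
  pose P : {poly rat} := (delta%:R * (size a)%:R) *: (p%:R%:P + 'X).
  exists (cauchyp u (fun n => n`!%:R^-1 *: P ^+ n)).
  apply: ptayl_ext (ptayl_mul Hu (ptayl_expR P)) => t z _.
  rewrite /tail_val -mulrA [tail_cst _ _ * _]mulrC; congr (_ * (expR _ * _)).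
  by rewrite /P evpZ evpD evpC evpX rmorphM /= !ratr_nat; ring.
have [u Hu] := IH a p.+1; have Hu' := ptayl_scale (e == 0%N)%:R Hu.
case: a Hu' {Hu} => [|x a] Hu'.
  exists (fun n => (e == 0%N)%:R *: u n); apply: ptayl_ext Hu' => t z _.
  by rewrite /= addr0 expr0 !mul1r ratr_nat.
have [v Hv] := IH a p.+1.
pose P : {poly rat} := delta%:R *: (p.+1%:R%:P + 'X).
(* A letter placed on the leading variable adds no pole, but [size a] counts it: the surplus factor
   [z] is the shift. *)
have Hv' := ptayl_scale (e == x)%:R (ptayl_mul (ptayl_expR P) (ptayl_shift Hv)).
exists (fun n => (e == 0%N)%:R *: u n + (e == x)%:R *:
  cauchyp (fun n => n`!%:R^-1 *: P ^+ n) (fun n => if n is n'.+1 then v n' else 0) n).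
apply: ptayl_ext (ptayl_add Hu' Hv') => t z _ /=.
rewrite !ratr_nat mulrDr; congr (_ + _); first by rewrite mulrCA.
rewrite /wt (_ : expR (evp t P * z) = expR (delta%:R * z * (p.+1%:R + t))).
  by rewrite exprS; ring.
by congr expR; rewrite /P evpZ evpD evpC evpX !ratr_nat; ring.
Qed.

End PolynomialTaylor.

Lemma expz_subn (K : fieldType) (z : K) (j N : nat) : z != 0 ->
  z ^ (j%:Z - N%:Z) = z ^+ j / z ^+ N.
Proof. by move=> z0; rewrite expfzDr // -exprnN -exprnP. Qed.

(** Convergence alone supplies the geometric bound of [tayl]: at $z_0=-e/2$ the terms are bounded,
    so the coefficients grow at most like $(e/2)^{-n}$. *)
Lemma laurent_sum_cvg_lau (K : realType) (c : int -> K) (G : K -> K) (N : nat) (e : K) :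
  (forall n : int, n < - N%:Z -> c n = 0) -> 0 < e ->
  (forall z, - e < z < 0 ->
    (fun J : nat => \sum_(j < J) c (j%:Z - N%:Z) * z ^ (j%:Z - N%:Z)) @ \oo --> G z) ->
  lau c G.
Proof.
move=> c0 e0 cG; exists N; split => //.
have sE z : z < 0 -> - e < z ->
    series (fun n => c (n%:Z - N%:Z) * z ^+ n) @ \oo --> z ^+ N * G z.
  move=> z0 ez; have zn0 : z != 0 by rewrite lt_eqF.
  rewrite (_ : series _ = (fun J => z ^+ N *
      \sum_(j < J) c (j%:Z - N%:Z) * z ^ (j%:Z - N%:Z))).
    by apply: cvgM; [exact: cvg_cst|apply: cG; rewrite ez].
  apply/funext => J; rewrite /series /= big_mkord mulr_sumr; apply: eq_bigr => j _.
  by rewrite expz_subn // [RHS]mulrC -!mulrA mulVf ?mulr1 // expf_neq0.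
pose z0 := - (e / 2); have z0n : z0 < 0 by rewrite /z0; lra.
have z0e : - e < z0 by rewrite /z0; lra.
have [B [_ HB]] := cvg_series_bounded (cvgP _ (sE z0 z0n z0e)).
have B1 : B < B + 1 by rewrite ltrDl.
exists (B + 1), (e / 2)^-1; have e2 : 0 < e / 2 by rewrite divr_gt0.
split => [|n|z zn zr]; first by rewrite invr_gt0.
  have := HB _ B1 n I; rewrite /= normrM normrX normrN (gtr0_norm e2).
  by rewrite exprVn ler_pdivlMr // exprn_gt0.
apply: sE => //; move: zr; rewrite ltr_pdivrMr // mul1r ltr0_norm // => zr.
by rewrite ltrNl; apply: lt_trans zr _; lra.
Qed.

Lemma laurent_sum_cvg (K : realType) (u : nat -> K) (l z : K) (N : nat) : z != 0 ->
  series (fun n => u n * z ^+ n) @ \oo --> z ^+ N * l ->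
  (fun J : nat => \sum_(j < J) u j * z ^ (j%:Z - N%:Z)) @ \oo --> l.
Proof.
move=> z0 H.
have cs : (fun=> z ^- N) @ \oo --> (z ^- N : K) by exact: cvg_cst.
have := cvgM cs H; rewrite mulKf ?expf_neq0 // => /(_ _).
rewrite (_ : (fun J : nat => \sum_(j < J) _) =
  (fun=> z ^- N) \* series (fun n => u n * z ^+ n)); first exact.
apply/funext => J; rewrite /series /= big_mkord mulr_sumr; apply: eq_bigr => j _.
by rewrite expz_subn // [RHS]mulrCA [z ^- N * _]mulrC.
Qed.

Lemma laurent_exp_lau F c G t : is_laurent_exp F c -> 0 <= t ->
  (forall z, z < 0 -> F t z = (G z)%:E) -> lau (fun n => evp t (c n)) G.
Proof.
move=> [N [c0 H]] t0 FG; have [e e0 He] := H t t0.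
apply: (@laurent_sum_cvg_lau _ _ _ N e) => // [n n0|z /andP[ez z0]].
  by rewrite c0 ?evp0.
by have [|l []] := He z; rewrite ?ez // FG // => -[<-].
Qed.

Lemma tayl_laurent_exp F (u : nat -> {poly rat}) (G : R -> R -> R) (N : nat) :
  ptayl u (fun t z => z ^+ N * G t z) ->
  (forall t z, z < 0 -> F t z = (G t z)%:E) ->
  is_laurent_exp F (fun n => if (n + N%:Z)%R is Posz q then u q else 0).
Proof.
move=> Hu FG; exists N; split => [n n0|t t0].
  by case E : (n + N%:Z) => [q|q] //; lia.
have [C [r [r0 _ Hr]]] := Hu t; exists r^-1; first by rewrite invr_gt0.
move=> z /andP[rz z0]; exists (G t z); split; first exact: FG.
have zn0 : z != 0 by rewrite lt_eqF.
have zr : `|z| * r < 1 by rewrite -ltr_pdivlMr // div1r ltr0_norm // ltrNl.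
under eq_fun do under eq_bigr do rewrite subrK.
exact: laurent_sum_cvg (Hr z z0 zr).
Qed.

Section PhiExpansion.
Variable delta : nat.
Hypothesis delta_gt0 : (0 < delta)%N.

Lemma phi_val_exp_sum a m t (z : R) : z < 0 ->
  phi_val a (nseq (size a) delta) m t z = (exp_sum (delta%:R * z) t 0 m a)%:E.
Proof.
move=> z0; have dz : delta%:R * z < 0 by rewrite pmulr_rlt0 // ltr0n.
rewrite -[exp_sum _ _ _ _ _]mul1r -(esum_incr_idx _ dz) // -idx_incr_idx.
apply: eq_esum => i [si _]; rewrite mul1r expR_sum (big_nth 0%N) big_mkord si.
congr EFin; apply: eq_bigr => l _; rewrite nth_nseq ltn_ord; congr expR; ring.
Qed.

(** [phi] takes an arbitrary valid expansion. One exists by [ptayl_exp_sum], and uniqueness of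
    Laurent coefficients at every natural $t$ transfers its pole bound [size a] to the chosen
    one. *)
Lemma phi_spec a m :
  (forall n : int, n < - (size a)%:Z -> phi a (nseq (size a) delta) m n = 0) /\
  forall t : R, 0 <= t ->
    lau (fun n => evp t (phi a (nseq (size a) delta) m n))
        (fun z => exp_sum (delta%:R * z) t 0 m a).
Proof.
set b := nseq _ _.
have [u Hu] := ptayl_exp_sum R delta_gt0 m a 0.
pose c n := if (n + (size a)%:Z)%R is Posz q then u q else 0.
have Hc : is_laurent_exp (phi_val a b m) c.
  by apply: tayl_laurent_exp Hu _ => t z; exact: phi_val_exp_sum.
have Hphi : is_laurent_exp (phi_val a b m) (phi a b m).
  have -> : phi a b m = projT1 (cid (ex_intro _ c Hc)).
    apply/funext => n; rewrite /phi; case: pselect => [H|/(_ (ex_intro _ c Hc))] //.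
    by rewrite (Prop_irrelevance H (ex_intro _ c Hc)).
  by case: cid.
have lauE c' (t : R) : is_laurent_exp (phi_val a b m) c' -> 0 <= t ->
    lau (fun n => evp t (c' n)) (fun z => exp_sum (delta%:R * z) t 0 m a).
  by move=> Hc' t0; apply: laurent_exp_lau Hc' t0 _ => z; exact: phi_val_exp_sum.
split => [n n0|t]; last exact: lauE.
have -> : phi a b m n = c n.
  apply: (@evp_nat_inj R) => k; have k0 : 0 <= k%:R :> R by [].
  exact: (lau_unique (lauE _ _ Hphi k0) (lauE _ _ Hc k0)).
by rewrite /c; case E : (n + (size a)%:Z) => [q|q] //; lia.
Qed.

End PhiExpansion.

(** * Birkhoff factorisation *)

Lemma size_splits m s : s \in splits m -> size s = size m /\ size (msub m s) = size m.
Proof.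
elim: m s => [|x m IH] s; first by rewrite inE => /eqP ->.
rewrite splits_cons => /allpairsPdep [i [s' [_ s'm ->]]].
by have [/= -> ->] := IH _ s'm.
Qed.

(** Members of [splits m] have the length of [m] and entries bounded by it, so only [m] itself has a
    trivial complement. *)
Lemma big_splits_msub0 (V : nmodType) m (f : mon -> V) :
  \sum_(s <- splits m) (if all0 (msub m s) then f s else 0) = f m.
Proof.
elim: m f => [|x m IH] f; first by rewrite big_seq1.
rewrite splits_cons big_allpairs_dep.
rewrite (bigD1_seq x) ?iota_uniq ?mem_iota //= [X in _ + X]big1_seq ?addr0.
  rewrite -(IH (fun s => f (x :: s))); apply: eq_bigr => s _.
  by rewrite /msub /= subnn.
move=> i /andP[ix]; rewrite -[_ :: _]/(iota 0 x.+1) mem_iota add0n ltnS => /andP[_ le_ix].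
apply: big1 => s _; rewrite /msub /= subn_eq0.
by rewrite leqNgt ltn_neqAle ix le_ix.
Qed.

Lemma lboundP (F : lser) (N : nat) : (forall m (n : int), n < - N%:Z -> F m n = 0) ->
  forall m (n : int), n < - (Defs.lbound F)%:Z -> F m n = 0.
Proof.
move=> H; rewrite /Defs.lbound; case: pselect => [H'|[]]; last by exists N.
by case: cid.
Qed.

Definition laurent_poly (C : {poly rat}) : lser :=
  fun m n => if all0 m && (n <= 0) then (C`_`|n|%N)%:P else 0.

(* [laurent_poly C] is the polynomial [C] in [1/z], constant in [X] and [t]. *)
Lemma lmul_laurent_poly (F : lser) (N : nat) (C : {poly rat}) :
  (forall m (n : int), n < - N%:Z -> F m n = 0) ->
  forall m n, lmul F (laurent_poly C) m n =
    \sum_(k < size C) F m (n + k%:Z) * (C`_k)%:P.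
Proof.
move=> HF m n; rewrite /lmul.
have LF := lboundP HF; have LG : forall m (n : int),
    n < - (Defs.lbound (laurent_poly C))%:Z -> laurent_poly C m n = 0.
  apply: (@lboundP _ (size C)) => {m n HF} m n nC.
  rewrite /laurent_poly; case: ifP => // _; rewrite nth_default ?polyC0 //.
  by move: (size C) nC => sz nC; lia.
move: LF LG; move: (Defs.lbound F) (Defs.lbound (laurent_poly C)) => A B LF LG.
have C0 k : (B < k)%N -> C`_k = 0.
  move=> Bk; have := LG [::] (- k%:Z); rewrite /laurent_poly /= oppr_le0 /=.
  by rewrite abszN absz_nat => H; apply/eqP; rewrite -polyC_eq0 H //; lia.
(* In the [Negz] case [lmul] is [0] by definition. The right side agrees: either $k>B$ and [C0]
   applies, or $n+k<-A$ and [F] vanishes. *)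
case E : (n + A%:Z + B%:Z) => [q|q]; last first.
  rewrite big1 // => k _; have [Bk|kB] := ltnP B k; first by rewrite C0 ?polyC0 ?mulr0.
  by rewrite LF ?mul0r //; lia.
transitivity (\sum_(s <- splits m) if all0 (msub m s) then \sum_(j < q.+1)
    F s (j%:Z - A%:Z) * (if n - (j%:Z - A%:Z) <= 0 then
      (C`_(absz (n - (j%:Z - A%:Z))%R))%:P else 0) else 0).
  apply: eq_bigr => s _; rewrite /laurent_poly; case: (all0 _) => //.
  by rewrite big1 // => j _; rewrite mulr0.
rewrite big_splits_msub0.
(* The degree in $1/z$ becomes an index [k] of its own, tied to [j] by $j=n+k+A$, so that the two
   sums can be exchanged. *)
transitivity (\sum_(j < q.+1) \sum_(k < size C)
    if j%:Z == n + k%:Z + A%:Z then F m (n + k%:Z) * (C`_k)%:P else 0).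
  apply: eq_bigr => j _; case: ifP => jn.
    have [kC|kC] := ltnP (absz (n - (j%:Z - A%:Z))%R) (size C).
      rewrite (bigD1 (Ordinal kC)) //= big1 ?addr0 => [|k /eqP kk].
        rewrite ifT; last by apply/eqP; lia.
        by congr (F m _ * _); lia.
      case: eqP => // jk; case: kk; apply: val_inj => /=; lia.
    rewrite nth_default // polyC0 mulr0 big1 // => k _; case: eqP => // jk.
    by have := ltn_ord k; lia.
  rewrite mulr0 big1 // => k _; case: eqP => // jk; lia.
rewrite exchange_big; apply: eq_bigr => k _.
case X : (n + k%:Z + A%:Z) => [x|x]; last first.
  by rewrite LF ?mul0r; [rewrite big1 // => j _; case: ifP|lia].
have [xq|qx] := ltnP x q.+1.
  rewrite (bigD1 (Ordinal xq)) //= eqxx big1 ?addr0 // => j /eqP jx.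
  by case: eqP => // -[?]; case: jx; apply: val_inj.
rewrite C0 ?polyC0 ?mulr0 ?big1 //; last by lia.
by move=> j _; case: ifP.
Qed.

Definition counter_word (delta : nat) (a : seq nat) : {poly rat} :=
  if all0 a then counter delta (size a) else 0.

Lemma counter_word_coef0 delta a : (0 < size a)%N -> (counter_word delta a)`_0 = 0.
Proof.
rewrite /counter_word; case: ifP; last by rewrite coef0.
by case: (size a) => // n _ _; rewrite counterS_coef0.
Qed.

Section LaurentCoefficients.
Variable K : realType.

Lemma lau_cst (x : K) : lau (fun n => (n == 0)%:R * x) (fun=> x).
Proof.
exists 0%N; split => [n n0|]; first by rewrite (_ : n == 0 = false) ?mul0r ?mul0r //; lia.
by apply: tayl_ext (tayl_cst x) => [j|z _]; rewrite ?subr0 // expr0 mul1r.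
Qed.

Lemma lau_mul_poly (c : int -> K) (F : K -> K) (C : {poly rat}) : lau c F ->
  lau (fun n => \sum_(k < size C) c (n + k%:Z) * ratr (C`_k))
      (fun z => F z * evp z^-1 C).
Proof.
move=> H; apply: lau_ext (lau_sum (index_enum 'I_(size C)) (fun k : 'I_(size C) =>
  lau_scale (ratr (C`_k)) (lau_shift k H))) => [n|z _].
  by apply: eq_bigr => k _; rewrite mulrC.
rewrite /evp horner_coef size_map_poly mulr_sumr; apply: eq_bigr => k _.
by rewrite coef_map /= exprVn; ring.
Qed.

Lemma exp_sum_word0 (s t : K) p m : exp_sum s t p m [::] = (all0 m)%:R.
Proof.
elim: m p => [|e m IH] p.
  by rewrite /= /tail_val /tail_cst big_ord0 mul0r mulr0 exp.expR0 mulr1.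
by rewrite /= IH addr0 -natrM mulnb.
Qed.

End LaurentCoefficients.

(** * Convolution with the counterterms and its limit *)

Section RenormalizedSum.
Variables (K : realType) (delta : nat).
Hypothesis delta_gt0 : (0 < delta)%N.
Implicit Types (z t : K) (p : nat) (m a : seq nat).

Definition ren_sum z t p m a : K :=
  \sum_(i < (size a).+1) exp_sum (delta%:R * z) t p m (take i a) *
    evp z^-1 (counter_word delta (drop i a)).

(** If some letter is positive, every cut leaves it in one of the two halves, and that half
    contributes [0]. *)
Lemma ren_sum_nil z t p a :
  ren_sum z t p [::] a = if all0 a then reg_tail delta z (p%:R + t) (size a) else 0.
Proof.
rewrite /ren_sum; case a0 : (all0 a).
  apply: eq_bigr => i _; rewrite /= /counter_word.
  have := a0; rewrite -{1}(cat_take_drop i a) all_cat => /andP[-> ->].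
  by rewrite size_takel ?leq_ord // size_drop.
apply: big1 => i _; rewrite /= /counter_word.
move: a0; rewrite -{1}(cat_take_drop i a) all_cat.
by case: (all0 (take i a)) => /= [->|_]; rewrite ?mul0r // evp0 mulr0.
Qed.

(** The recursion of [exp_sum] is inherited because a leading variable affects only the left half of
    each cut; the empty left half of [i = 0] has no letter to place. *)
Lemma ren_sum_cons z t p e m a : ren_sum z t p (e :: m) a =
  (e == 0%N)%:R * ren_sum z t p.+1 m a +
  (if a is x :: a' then
     (e == x)%:R * (wt (delta%:R * z) t p.+1 * ren_sum z t p.+1 m a') else 0).
Proof.
case: a => [|x a]; first by rewrite /ren_sum !big_ord1 /= !addr0 mulrA.
rewrite /ren_sum big_ord_recl [in RHS]big_ord_recl.
under eq_bigr do rewrite /= mulrDl.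
rewrite big_split /= !mulrDr !mulr_sumr addr0 -!addrA mulrA; congr (_ + _).
by congr (_ + _); apply: eq_bigr => i _; rewrite -!mulrA.
Qed.

(** As $z\to0$ the weights [wt] tend to $1$, and [ren_sum] acquires the recursion of [coefv]; the
    empty monomial is [reg_tail_lim]. *)
Lemma ren_sum_lim t m a p : ren_sum z t p m a @[z --> (0 : K)^'-] -->
  coefv (- (p%:R + t + 2^-1) - (size m)%:R) m a.
Proof.
elim: m a p => [|e m IH] a p.
  apply: (@near_left0_cvg _ (fun z => if all0 a then
    reg_tail delta z (p%:R + t) (size a) else 0)) => [z _|].
    by rewrite ren_sum_nil.
  by rewrite subr0 /=; case: (all0 a); [exact: reg_tail_lim|exact: cvg_cst].
apply: (@near_left0_cvg _ (fun z => (e == 0%N)%:R * ren_sum z t p.+1 m a +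
  (if a is x :: a' then
     (e == x)%:R * (wt (delta%:R * z) t p.+1 * ren_sum z t p.+1 m a') else 0))).
  by move=> z _; rewrite ren_sum_cons.
(* Raising [p] while dropping one exponent leaves the parameter of [coefv] unchanged. *)
have cE : - (p%:R + t + 2^-1) - (size (e :: m))%:R =
    - (p.+1%:R + t + 2^-1) - (size m)%:R :> K.
  by rewrite /= -!natr1; ring.
rewrite cE /=; apply: cvgD; first by apply: cvgM; [exact: cvg_cst|exact: IH].
case: a => [|x a]; first exact: cvg_cst.
apply: cvgM; first exact: cvg_cst.
rewrite -[coefv _ m a]mul1r; apply: cvgM; last exact: IH.
have := tayl_lim (tayl_expR (delta%:R * (p.+1%:R + t) : K)).
rewrite expr0 fact0 divr1; apply: near_left0_cvg => z _.
by rewrite /wt; congr expR; ring.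
Qed.

End RenormalizedSum.

(** * Solving the renormalization recursion *)

Section Renormalization.
Variable delta : nat.
Hypothesis delta_gt0 : (0 < delta)%N.
Notation dl a := (nseq (size a) delta).
Notation counter_word := (counter_word delta).
Notation ren_sum := (@ren_sum R delta).

Lemma bar_phi_coef (phim : seq nat -> seq nat -> lser) a m n :
  (forall s, (0 < size s < size a)%N -> phim s (dl s) = laurent_poly (counter_word s)) ->
  bar_phi phim a (dl a) m n = phi a (dl a) m n +
    \sum_(1 <= i < size a) \sum_(k < size (counter_word (drop i a)))
      phi (take i a) (dl (take i a)) m (n + k%:Z) * ((counter_word (drop i a))`_k)%:P.
Proof.
move=> Hm; rewrite /bar_phi /ladd /lsum; congr (_ + _).
rewrite big_map; apply: eq_big_nat => i /andP[i1 ia].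
have -> : take i (dl a) = dl (take i a) by rewrite take_nseq ?size_take ?ia // ltnW.
have -> : drop i (dl a) = dl (drop i a) by rewrite drop_nseq size_drop.
rewrite Hm; last by rewrite size_drop; lia.
apply: (@lmul_laurent_poly _ (size (take i a))) => {}m {}n.
by have [H _] := phi_spec delta_gt0 (take i a) m; exact: H.
Qed.

(* [bar_phi] is [ren_sum] without its [i = 0] term, which is the counterterm. *)
Lemma lau_bar_phi (phim : seq nat -> seq nat -> lser) a m (t : R) :
  (0 < size a)%N -> 0 <= t ->
  (forall s, (0 < size s < size a)%N -> phim s (dl s) = laurent_poly (counter_word s)) ->
  lau (fun n => evp t (bar_phi phim a (dl a) m n + laurent_poly (counter_word a) m n))
    (fun z => ren_sum z t 0 m a).
Proof.
move=> a0 t0 Hm.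
have L s : lau (fun n => evp t (phi s (dl s) m n)) (fun z => exp_sum (delta%:R * z) t 0 m s).
  by have [_] := phi_spec delta_gt0 s m; apply.
have H0 := lau_mul_poly (counter_word a) (lau_cst ((all0 m)%:R : R)).
have Hs := lau_sum (index_iota 1 (size a)) (fun i =>
  lau_mul_poly (counter_word (drop i a)) (L (take i a))).
(* [H0] is the cut [i = 0], [Hs] collects the interior cuts, and [L a] is the cut [i = size a]. *)
apply: lau_ext (lau_add (lau_add H0 Hs) (L a)) => [n|z z0].
  rewrite bar_phi_coef // !evpD evp_sum.
  rewrite addrC -addrA; congr (_ + _); rewrite addrC; congr (_ + _); last first.
    by apply: eq_bigr => i _; rewrite evp_sum; apply: eq_bigr => k _; rewrite evpM evpC.
  rewrite /laurent_poly; case: (all0 m) => /=; last first.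
    by rewrite evp0 big1 // => k _; rewrite mulr0 mul0r.
  case: ifP => n0; last first.
    rewrite evp0 big1 // => k _; rewrite (_ : n + k%:Z == 0 = false) ?mul0r ?mul0r //.
    by lia.
  rewrite evpC; have [nC|nC] := ltnP `|n|%N (size (counter_word a)).
    rewrite (bigD1 (Ordinal nC)) //= big1 ?addr0 => [|k /eqP kn].
      by rewrite (_ : n + _ == 0 = true) ?mulr1 ?mul1r //; lia.
    rewrite (_ : n + k%:Z == 0 = false) ?mul0r ?mul0r //; apply/negP => /eqP nk.
    by apply: kn; apply: val_inj => /=; lia.
  rewrite nth_default // rmorph0 big1 // => k _.
  rewrite (_ : n + k%:Z == 0 = false) ?mul0r ?mul0r //; apply/negP => /eqP nk.
  have kn : k = absz n :> nat by lia.
  by have := ltn_ord k; rewrite kn ltnNge nC.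
rewrite /ren_sum big_ord_recl take0 drop0 exp_sum_word0 -addrA; congr (_ + _).
rewrite -(big_mkord xpredT (fun i => exp_sum (delta%:R * z) t 0 m (take i.+1 a) *
  evp z^-1 (counter_word (drop i.+1 a)))) -(big_add1 _ _ 0 (size a).+1 xpredT
  (fun i => exp_sum (delta%:R * z) t 0 m (take i a) * evp z^-1 (counter_word (drop i a)))).
rewrite big_nat_recr //= take_size drop_size; congr (_ + _).
by rewrite /counter_word /= counter0 evp1 mulr1.
Qed.

(** Adding the counterterm to [bar_phi] gives a finite limit at $z=0$. Hence the counterterm cancels
    the polar part, and having no constant term, it leaves the limit as the coefficient of $z^0$. *)
Lemma bar_phi_spec (phim : seq nat -> seq nat -> lser) a m :
  (0 < size a)%N ->
  (forall s, (0 < size s < size a)%N -> phim s (dl s) = laurent_poly (counter_word s)) ->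
  (forall n : int, n < 0 ->
     bar_phi phim a (dl a) m n = - laurent_poly (counter_word a) m n) /\
  forall k : nat, evp k%:R (bar_phi phim a (dl a) m 0) =
    coefv (- (k%:R + 2^-1) - (size m)%:R) m a :> R.
Proof.
move=> a0 Hm.
have H (k : nat) := lau_lim (lau_bar_phi m a0 (ler0n R k) Hm)
  (@ren_sum_lim R delta delta_gt0 k%:R m a 0).
split=> [n n0|k].
  apply/eqP; rewrite -addr_eq0; apply/eqP; apply: (@evp_nat_inj R) => k.
  by have [H1 _] := H k; rewrite evp0 H1.
have [_] := H k; rewrite add0r evpD /laurent_poly lexx andbT absz0.
by rewrite counter_word_coef0 // if_same evp0 addr0.
Qed.

(** By [bar_phi_spec] the polar part of [bar_phi] is minus the counterterm. Only proper suffixes are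
    visited, so any fuel at least [size a] works. *)
Lemma phi_minus_spec n a : (0 < size a <= n)%N ->
  phi_minus_fuel n a (dl a) = laurent_poly (counter_word a).
Proof.
elim: n a => [|n IH] a /andP[a0 an]; first by lia.
apply/funext => m; apply/funext => k /=; rewrite /lopp /lpolar.
have Hs s : (0 < size s < size a)%N ->
    phi_minus_fuel n s (dl s) = laurent_poly (counter_word s).
  by move=> /andP[s0 sa]; apply: IH; rewrite s0 -ltnS (leq_trans sa).
have [H _] := bar_phi_spec m a0 Hs.
case: ifP => k0; first by rewrite H ?opprK.
rewrite oppr0 /laurent_poly; case: ifP => // /andP[_ k0'].
(* [lpolar] excludes degree $0$ while [laurent_poly] admits it; they agree because the counterterm
   has no constant term. *)
have -> : k = 0 by apply/eqP; rewrite eq_le k0' leNgt k0.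
by rewrite absz0 counter_word_coef0.
Qed.

(** The right side is free of [delta], so this also shows that $M_\alpha$ does not depend on
    $\delta$. *)
Lemma Mren_spec a m (k : nat) : evp k%:R (Mren delta a m) =
  coefv (- (k%:R + 2^-1) - (size m)%:R) m a :> R.
Proof.
case: a => [|x a].
  have -> : coefv _ m [::] = (all0 m)%:R :> R.
    by elim: m => [|e m IH] c //=; rewrite ?binr0 // IH addr0 -natrM mulnb.
  by rewrite /Mren /sone; case: (all0 m); rewrite ?evp1 ?evp0.
(* With [a] now the tail of the word, the fuel [size a] of [phi_plus] just covers the proper
   suffixes. *)
have [//|s /andP[s0 ss]|_ H] := @bar_phi_spec (phi_minus_fuel (size a)) (x :: a) m.
  by apply: phi_minus_spec; rewrite s0.
exact: H.
Qed.

(** Members of [splits m] and their complements are as long as [m], so at $t=k$ both factors and the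
    quasi-shuffle side share one parameter of [coefv], and [qsh_mult_all] applies. *)
Lemma Mren_qsh a b m :
  smul (Mren delta a) (Mren delta b) m = \sum_(w <- qsh a b) Mren delta w m.
Proof.
apply: (@evp_nat_inj R) => k; rewrite /smul !evp_sum.
under [RHS]eq_bigr do rewrite Mren_spec.
rewrite -qsh_mult_all big_seq [RHS]big_seq; apply: eq_bigr => m1 /size_splits [s1 s2].
by rewrite evpM !Mren_spec s1 s2.
Qed.

End Renormalization.

(** * Closure of [RenQSym] under the algebra operations *)

Lemma smul_suml (k : comNzRingType) (I : Type) (s : seq I)
    (F : I -> mon -> {poly k}) (g : mon -> {poly k}) m :
  smul (fun m => \sum_(i <- s) F i m) g m = \sum_(i <- s) smul (F i) g m.
Proof. by rewrite exchange_big; apply: eq_bigr => m1 _; rewrite mulr_suml. Qed.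

Lemma smul_sumr (k : comNzRingType) (I : Type) (s : seq I)
    (F : I -> mon -> {poly k}) (g : mon -> {poly k}) m :
  smul g (fun m => \sum_(i <- s) F i m) m = \sum_(i <- s) smul g (F i) m.
Proof. by rewrite exchange_big; apply: eq_bigr => m1 _; rewrite mulr_sumr. Qed.

Lemma smulZ (k : comNzRingType) (x y : k) (f g : mon -> {poly k}) m :
  smul (fun m => x *: f m) (fun m => y *: g m) m = (x * y) *: smul f g m.
Proof.
rewrite scaler_sumr; apply: eq_bigr => m1 _.
by rewrite -scalerAl -scalerAr scalerA.
Qed.

Lemma embed_smul (k : comAlgType rat) (f g : qser) m :
  smul (embed k f) (embed k g) m = embed k (smul f g) m.
Proof.
by rewrite /embed /smul rmorph_sum; apply: eq_bigr => m1 _; rewrite rmorphM.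
Qed.

Theorem theorem5p1 :
  forall delta : nat, (0 < delta)%N ->
  (forall (a b : seq nat) (m : mon),
      smul (Mren delta a) (Mren delta b) m = \sum_(w <- qsh a b) Mren delta w m)
  /\
  (forall k : comAlgType rat,
      RenQSym k delta (sone k)
   /\ (forall f g, RenQSym k delta f -> RenQSym k delta g ->
         RenQSym k delta (fun m => f m + g m))
   /\ (forall (c : k) f, RenQSym k delta f -> RenQSym k delta (fun m => c *: f m))
   /\ (forall f g, RenQSym k delta f -> RenQSym k delta g ->
         RenQSym k delta (smul f g))).
Proof.
move=> delta d0; have M := Mren_qsh d0; split => // k; split; last split; last split.
- exists [:: (1, [::])] => m; rewrite big_seq1 scale1r /embed /= /sone.
  by case: ifP; rewrite ?rmorph1 ?rmorph0.
- move=> f g [s fs] [s' gs]; exists (s ++ s') => m.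
  by rewrite big_cat /= fs gs.
- move=> c f [s fs]; exists [seq (c * p.1, p.2) | p <- s] => m.
  by rewrite big_map fs scaler_sumr; apply: eq_bigr => p _; rewrite scalerA.
- move=> f g [s fs] [s' gs].
  (* Each pair of terms is replaced by the words of its quasi-shuffle, all weighted by the product
     of the two coefficients. *)
  exists (flatten [seq [seq (p.1 * p'.1, w) | w <- qsh p.2 p'.2] | p <- s, p' <- s']) => m.
  rewrite (funext fs) (funext gs) smul_suml big_flatten big_allpairs_dep.
  apply: eq_bigr => p _; rewrite smul_sumr; apply: eq_bigr => p' _.
  rewrite smulZ embed_smul big_map /embed M rmorph_sum scaler_sumr.
  by apply: eq_bigr.
Qed.
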